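(* Let $D$ be an integral domain and let $R$ be a pseudo-polynomial retract $D$-algebra. Let $\Theta$ be a pre-Jaffard family of $D$, and let $\{T_\alpha\}$ be the derived sequence with respect to $\Theta$. Fix an ordinal $\alpha$ and suppose that $\mathrm{LPic}_u(RT,T)$ is a free abelian group for each $T\in\Theta\setminus\mathcal{N}^\alpha(\Theta)$. Then there is an exact sequence $$0\longrightarrow\bigoplus_{T\in\Theta\setminus\mathcal{N}^\alpha(\Theta)}\mathrm{LPic}_u(RT,T)\longrightarrow\mathrm{LPic}_u(R,D)\longrightarrow\mathrm{LPic}_u(RT_\alpha,T_\alpha)\longrightarrow 0.$$
   Context: All rings are commutative with unit; $D$ is an integral domain that is not a field, with quotient field $K\neq D$. If $A\subseteq B$ are integral domains, the quotient field of $A$ is viewed inside the quotient field of $B$. A fractional ideal of a domain $B$ is a $B$-submodule $I$ of its quotient field with $bI\subseteq B$ for some nonzero $b\in B$; it is integral if $I\subseteq B$. $\mathrm{Inv}(B)$ is the group of invertible fractional ideals of $B$, $\mathrm{Princ}(B)$ the subgroup of nonzero principal fractional ideals, $\mathrm{Pic}(B)=\mathrm{Inv}(B)/\mathrm{Princ}(B)$. A retract $D$-algebra is a $D$-algebra $R$ that is an integral domain and admits a $D$-algebra homomorphism $\epsilon:R\to D$ (then $D\subseteq R$). For an extension $A\subseteq B$ of integral domains, with $F$ the quotient field of $A$: a fractional ideal $I$ of $B$ is unitary with respect to $A$ if $I\cap F\neq(0)$. $\mathrm{Inv}_u(B,A)$ is the subgroup of $\mathrm{Inv}(B)$ generated by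 the invertible ideals that are both integral and unitary with respect to $A$; $\mathrm{Pic}_u(B,A):=\mathrm{Inv}_u(B,A)/(\mathrm{Inv}_u(B,A)\cap\mathrm{Princ}(B))$, a subgroup of $\mathrm{Pic}(B)$. The canonical map $\iota:\mathrm{Pic}(A)\to\mathrm{Pic}(B)$, $[I]\mapsto[IB]$, has image in $\mathrm{Pic}_u(B,A)$, and $\mathrm{LPic}_u(B,A):=\mathrm{Pic}_u(B,A)/\iota(\mathrm{Pic}(A))$. $B$ is pseudo-polynomial over $A$ (a pseudo-polynomial $A$-algebra) if every principal integral ideal of $B$ that is unitary with respect to $A$ is generated by an element of $A$. An overring of $D$ is a ring between $D$ and $K$; it is flat if it is flat as a $D$-module. $RT$ is the subring of the quotient field of $R$ consisting of finite sums $\sum r_it_i$ with $r_i\in R$, $t_i\in T$. A family $\Theta$ of flat overrings of $D$ is complete if $I=\bigcap_{T\in\Theta}IT$ for every ideal $I$ of $D$; independent if $TT'=K$ for all $T\neq T'$ in $\Theta$; locally finite if every nonzero $x\in D$ is a non-unit in only finitely many $T\in\Theta$. A Jaffard family of $D$ is a complete, independent, locally finite family of flat overrings with $K\notin\Theta$; a Jaffard overring of $D$ is a member of some Jaffard family of $D$. The Zariski topology on the set of overrings of $D$ is generated by the sets of all overrings containing $x$, for $x\in K$. A pre-Jaffard family of $D$ is a complete, independent family $\Theta$ of flat overrings of $D$, compact in the Zariski topology, with $K\notin\Theta$. For a pre-Jaffard family $\Theta$ of $D$ define by transfinite recursion: $\mathcal{N}^0(\Theta):=\Theta$, $T_0:=D$;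 if $\alpha=\gamma+1$, $\mathcal{N}^\alpha(\Theta)$ is the set of members of $\mathcal{N}^\gamma(\Theta)$ that are not Jaffard overrings of $T_\gamma$; if $\alpha$ is a limit ordinal, $\mathcal{N}^\alpha(\Theta):=\bigcap_{\gamma<\alpha}\mathcal{N}^\gamma(\Theta)$; and $T_\alpha:=\bigcap\{T\mid T\in\mathcal{N}^\alpha(\Theta)\}$, the empty intersection being $K$. $\{T_\alpha\}_\alpha$ is the derived sequence with respect to $\Theta$. *)

(* Defs.v *)
From HB Require Import structures.
From mathcomp Require Import all_boot all_order all_algebra.
From mathcomp Require Import mathcomp_extra boolp classical_sets functions.
From mathcomp Require Import cardinality topology.

Set Implicit Arguments.
Unset Strict Implicit.
Unset Printing Implicit Defensive.

Import Order.TTheory GRing.Theory.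
Local Open Scope classical_set_scope.
Local Open Scope ring_scope.

(* [tensor0 s] says that [\sum_(p <- s) p.1 \otimes p.2 = 0] in the tensor
   product of M and N over A, expressed through its universal property: the sum
   is killed by every bilinear map. *)
Definition tensor0 (A : comNzRingType) (M N : lmodType A) (s : seq (M * N)) :=
  forall (P : lmodType A) (b : {bilinear M -> N -> P}),
    \sum_(p <- s) b p.1 p.2 = 0.

(* [M \otimes f] is injective for every injective linear map [f]. *)
Definition flat_module (A : comNzRingType) (M : lmodType A) :=
  forall (N N' : lmodType A) (f : {linear N -> N'}), injective f ->
  forall s : seq (M * N), tensor0 [seq (p.1, f p.2) | p <- s] -> tensor0 s.

Section DirectSum.
Variables (I : Type) (G : I -> zmodType).

Record dsum := Dsum {
  dsum_fun :> forall i, G i;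
  dsum_finite : finite_set [set i | dsum_fun i != 0] }.

Lemma dsumP (f g : dsum) : (forall i, f i = g i) -> f = g.
Proof.
case: f g => f Hf [g Hg] /= fg; have {}fg : f = g by exact: functional_extensionality_dep.
by subst g; congr Dsum; exact: Prop_irrelevance.
Qed.

Lemma dsum0_subproof : finite_set [set i | (0 : G i) != 0].
Proof. by rewrite (_ : [set _ | _] = set0)// -subset0 => i /=; rewrite eqxx. Qed.
Definition dsum0 := Dsum dsum0_subproof.

Lemma dsumN_subproof (f : dsum) : finite_set [set i | - f i != 0].
Proof. by apply: sub_finite_set (dsum_finite f) => i /=; rewrite oppr_eq0. Qed.
Definition dsumN f := Dsum (dsumN_subproof f).

Lemma dsumD_subproof (f g : dsum) : finite_set [set i | f i + g i != 0].
Proof.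
have: finite_set ([set i | f i != 0] `|` [set i | g i != 0]).
  by rewrite finite_setU; split; exact: dsum_finite.
apply: sub_finite_set => i /=; have [->|] := eqVneq (f i) 0; last by left.
by rewrite add0r; right.
Qed.
Definition dsumD f g := Dsum (dsumD_subproof f g).

HB.instance Definition _ := gen_eqMixin dsum.
HB.instance Definition _ := gen_choiceMixin dsum.

Lemma dsumDA : associative dsumD.
Proof. by move=> f g h; apply: dsumP => i /=; rewrite addrA. Qed.
Lemma dsumDC : commutative dsumD.
Proof. by move=> f g; apply: dsumP => i /=; rewrite addrC. Qed.
Lemma dsum0D : left_id dsum0 dsumD.
Proof. by move=> f; apply: dsumP => i /=; rewrite add0r. Qed.
Lemma dsumND : left_inverse dsum0 dsumN dsumD.
Proof. by move=> f; apply: dsumP => i /=; rewrite addNr. Qed.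

HB.instance Definition _ := GRing.isZmodule.Build dsum dsumDA dsumDC dsum0D dsumND.

End DirectSum.

Definition free_abelian (G : zmodType) :=
  exists (I : Type) (f : {additive dsum (fun _ : I => int) -> G}), bijective f.

Definition short_exact (X Y Z : zmodType) (f : {additive X -> Y})
    (g : {additive Y -> Z}) :=
  [/\ injective f, (forall y, g y = 0 <-> exists x, y = f x)
    & forall z, exists y, z = g y].

(* Every domain is a subring of an ambient field L; its quotient field is taken
   inside L, and ideals, overrings and products are subsets of L. *)

Record subring (L : fieldType) := Subring {
  subring_set :> set L;
  subringP : subring_closed [in subring_set] }.

Identity Coercion set_funclass : set >-> Funclass.

Section Subrings.
Variable L : fieldType.
Implicit Types (A B D T : subring L) (X Y Z I J : set L).

Lemma subring_eq A B : A = B :> set L -> A = B.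
Proof.
case: A B => A HA [B HB] /= AB; subst B; congr Subring.
exact: Prop_irrelevance.
Qed.

Lemma subringE X :
  X 1 -> (forall x y, X x -> X y -> X (x - y)) ->
  (forall x y, X x -> X y -> X (x * y)) -> subring_closed [in X].
Proof.
by move=> X1 XB XM; split=> [|x y|x y]; rewrite ?inE //; [exact: XB|exact: XM].
Qed.

Lemma subring1 B : B 1.
Proof. by case: (subringP B); rewrite inE. Qed.
Lemma subringB B x y : B x -> B y -> B (x - y).
Proof. by case: (subringP B) => _ h _ Bx By; have := h x y; rewrite !inE; apply. Qed.
Lemma subringM B x y : B x -> B y -> B (x * y).
Proof. by case: (subringP B) => _ _ h Bx By; have := h x y; rewrite !inE; apply. Qed.
Lemma subring0 B : B 0.
Proof. by rewrite -(subrr 1); apply: subringB; exact: subring1. Qed.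
Lemma subringN B x : B x -> B (- x).
Proof. by move=> Bx; rewrite -sub0r; apply: subringB => //; exact: subring0. Qed.
Lemma subringD B x y : B x -> B y -> B (x + y).
Proof. by move=> Bx By; rewrite -(opprK y); apply: subringB => //; exact: subringN. Qed.

Definition insub_pred B : {pred L} := fun x => x \in (B : set L).
HB.instance Definition _ B :=
  GRing.isSubringClosed.Build L (insub_pred B) (subringP B).

Definition sring B := {x : L | x \in insub_pred B}.
HB.instance Definition _ B := SubChoice.on (sring B).
HB.instance Definition _ B := [SubChoice_isSubComNzRing of sring B by <:].

Definition overmod B T (BT : B `<=` T) := sring T.

Section OverMod.
Variables (B T : subring L) (BT : B `<=` T).
Local Notation M := (overmod BT).
HB.instance Definition _ := GRing.Zmodule.on M.

Lemma scale_subproof (b : sring B) (t : M) :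
  \val b * \val (t : sring T) \in insub_pred T.
Proof.
apply: rpredM; last exact: (valP (t : sring T)).
by have := valP b; rewrite !unfold_in !inE; exact: BT.
Qed.
Definition overmod_scale (b : sring B) (t : M) : M :=
  Sub (\val b * \val (t : sring T)) (scale_subproof b t) : sring T.

Lemma overmod_scaleA a b t :
  overmod_scale a (overmod_scale b t) = overmod_scale (a * b) t.
Proof. by apply: (@val_inj _ _ (sring T)); rewrite /= mulrA. Qed.
Lemma overmod_scale1 : left_id 1 overmod_scale.
Proof. by move=> t; apply: (@val_inj _ _ (sring T)); rewrite /= mul1r. Qed.
Lemma overmod_scaleDr : right_distributive overmod_scale +%R.
Proof. by move=> a t u; apply: (@val_inj _ _ (sring T)); rewrite /= mulrDr. Qed.
Lemma overmod_scaleDl t : {morph overmod_scale^~ t : a b / a + b}.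
Proof. by move=> a b; apply: (@val_inj _ _ (sring T)); rewrite /= mulrDl. Qed.

HB.instance Definition _ := GRing.Zmodule_isLmodule.Build (sring B) M
  overmod_scaleA overmod_scale1 overmod_scaleDr overmod_scaleDl.
End OverMod.

Definition qset B : set L :=
  [set x | exists a b, [/\ B a, B b, b != 0 & x = a / b]].

Lemma qset_subproof B : subring_closed [in qset B].
Proof.
apply: subringE.
- by exists 1, 1; split; rewrite ?oner_eq0 ?divr1 //; exact: subring1.
- move=> x y [a [b [Ba Bb b0 ->]]] [c [d [Bc Bd d0 ->]]].
  exists (a * d - c * b), (b * d); split; rewrite ?mulf_neq0 //.
  + by apply: subringB; exact: subringM.
  + exact: subringM.
  + rewrite -mulNr addf_div //; congr (_ / _); by rewrite mulNr.
- move=> x y [a [b [Ba Bb b0 ->]]] [c [d [Bc Bd d0 ->]]].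
  exists (a * c), (b * d); split; rewrite ?mulf_neq0 ?mulf_div //; exact: subringM.
Qed.

Definition quot B : subring L := Subring (@qset_subproof B).

Lemma sub_quot B : B `<=` quot B.
Proof.
by move=> x Bx; exists x, 1; split; rewrite ?oner_eq0 ?divr1 //; exact: subring1.
Qed.

(* Finite sums of products; this gives IJ, IB, IT, TT' and RT alike. *)
Definition pmul X Y : set L :=
  [set z | exists s : seq (L * L),
     (forall p, p \in s -> X p.1 /\ Y p.2) /\ z = \sum_(p <- s) p.1 * p.2].

Lemma pmul0 X Y : pmul X Y 0.
Proof. by exists [::]; rewrite big_nil. Qed.
Lemma pmulD X Y z w : pmul X Y z -> pmul X Y w -> pmul X Y (z + w).
Proof.
move=> [s [Hs ->]] [t [Ht ->]]; exists (s ++ t); rewrite big_cat; split=> // p.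
by rewrite mem_cat => /orP[/Hs|/Ht].
Qed.
Lemma pmul_mem X Y x y : X x -> Y y -> pmul X Y (x * y).
Proof. by exists [:: (x, y)]; rewrite big_seq1; split=> // p; rewrite inE => /eqP->. Qed.
Lemma pmul_ind X Y (P : L -> Prop) :
  P 0 -> (forall z w, P z -> P w -> P (z + w)) ->
  (forall x y, X x -> Y y -> P (x * y)) -> pmul X Y `<=` P.
Proof.
move=> P0 PD PM z [s [Hs ->]]; elim: s Hs => [|p s IH] Hs.
  by rewrite big_nil.
rewrite big_cons; apply: PD.
  by have [? ?] := Hs p (mem_head _ _); exact: PM.
by apply: IH => q qs; apply: Hs; rewrite inE qs orbT.
Qed.

Lemma pmulC X Y : pmul X Y = pmul Y X.
Proof.
suff H U V : pmul U V `<=` pmul V U by apply/seteqP.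
apply: pmul_ind => [|z w|x y Ux Vy]; [exact: pmul0|exact: pmulD|].
by rewrite mulrC; exact: pmul_mem.
Qed.

Lemma pmulA X Y Z : pmul X (pmul Y Z) = pmul (pmul X Y) Z.
Proof.
have H U V W : pmul U (pmul V W) `<=` pmul (pmul U V) W.
  apply: pmul_ind => [|z w|x y Ux]; [exact: pmul0|exact: pmulD|].
  apply: (@pmul_ind V W (fun y => pmul (pmul U V) W (x * y))) => [|z w Hz Hw|v w Vv Ww].
  - by rewrite mulr0; exact: pmul0.
  - by rewrite mulrDr; exact: pmulD.
  - by rewrite mulrA; apply: pmul_mem => //; exact: pmul_mem.
apply/seteqP; split; first exact: H.
have := H Z Y X.
by rewrite (pmulC Z (pmul Y X)) (pmulC Y X) (pmulC (pmul Z Y)) (pmulC Z Y).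
Qed.

Lemma pmulS X X' Y Y' : X `<=` X' -> Y `<=` Y' -> pmul X Y `<=` pmul X' Y'.
Proof.
move=> XX YY; apply: pmul_ind => [|z w|x y Xx Yy]; [exact: pmul0|exact: pmulD|].
by apply: pmul_mem; [exact: XX|exact: YY].
Qed.

Lemma pmul_subproof A B : subring_closed [in pmul A B].
Proof.
have HM x y : pmul A B x -> pmul A B y -> pmul A B (x * y).
  move=> + Hy.
  apply: (@pmul_ind A B (fun x => pmul A B (x * y))) => [|z w Hz Hw|a b Aa Bb].
  - by rewrite mul0r; exact: pmul0.
  - by rewrite mulrDl; exact: pmulD.
  - apply: (@pmul_ind A B (fun y => pmul A B (a * b * y)) _ _ _ _ Hy) => [|z w Hz Hw|c d Ac Bd].
    + by rewrite mulr0; exact: pmul0.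
    + by rewrite mulrDr; exact: pmulD.
    + by rewrite mulrACA; apply: pmul_mem; exact: subringM.
apply: subringE => //.
  by rewrite -(mulr1 1); apply: pmul_mem; exact: subring1.
move=> x y Hx Hy; apply: pmulD => //; rewrite -mulN1r; apply: HM => //.
by rewrite -(mulr1 (-1)); apply: pmul_mem; [apply: subringN|]; exact: subring1.
Qed.

Definition rmul A B : subring L := Subring (@pmul_subproof A B).

Lemma sub_rmulr A B : B `<=` rmul A B.
Proof. by move=> x Bx; rewrite -(mul1r x); apply: pmul_mem => //; exact: subring1. Qed.

Definition pmul1 x Y : set L := [set x * y | y in Y].

Definition submodule B I :=
  [/\ I 0, (forall x y, I x -> I y -> I (x + y))
    & forall b x, B b -> I x -> I (b * x)].

Definition fractional B I :=
  [/\ submodule B I, I `<=` quot B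
    & exists2 b, B b /\ b != 0 & pmul1 b I `<=` B].

Definition integral B I := I `<=` B.

Definition ideal B I := submodule B I /\ I `<=` B.

Definition invertible B I :=
  fractional B I /\ exists2 J, fractional B J & pmul I J = B.

Definition unitary A I := I `&` quot A <> [set 0].

Definition principal B I := exists x, [/\ quot B x, x != 0 & I = pmul1 x B].

Definition pseudo_polynomial B A :=
  forall x, quot B x -> integral B (pmul1 x B) -> unitary A (pmul1 x B) ->
  exists2 a, A a & pmul1 x B = pmul1 a B.

Lemma fractional1 B : fractional B B.
Proof.
split; last 2 first.
- exact: sub_quot.
- exists 1; first by split; [exact: subring1|exact: oner_neq0].
  by move=> _ [y By <-]; rewrite mul1r.
by split; [exact: subring0|move=> x y; exact: subringD|move=> b x; exact: subringM].
Qed.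

Lemma fractionalM B I J : fractional B I -> fractional B J -> fractional B (pmul I J).
Proof.
move=> [[I0 ID IM] IQ [b [Bb b0] bI]] [[J0 JD JM] JQ [c [Bc c0] cJ]]; split.
- split; [exact: pmul0|by move=> x y; exact: pmulD|].
  move=> a x Ba; move: x.
  apply: (@pmul_ind I J (fun x => pmul I J (a * x))) => [|z w Hz Hw|x y Ix Jy].
  + by rewrite mulr0; exact: pmul0.
  + by rewrite mulrDr; exact: pmulD.
  + by rewrite mulrA; apply: pmul_mem => //; exact: IM.
- apply: pmul_ind => [|z w|x y Ix Jy]; [exact: subring0|exact: subringD|].
  by apply: subringM; [exact: IQ|exact: JQ].
- exists (b * c); first by split; [exact: subringM|rewrite mulf_neq0].
  move=> _ [z Hz <-]; move: z Hz.
  apply: (@pmul_ind I J (fun z => B (b * c * z))) => [|z w Hz Hw|x y Ix Jy].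
  + by rewrite mulr0; exact: subring0.
  + by rewrite mulrDr; exact: subringD.
  + by rewrite mulrACA; apply: subringM; [apply: bI; exists x|apply: cJ; exists y].
Qed.

Lemma pmul1l B I : submodule B I -> pmul B I = I.
Proof.
move=> [I0 ID IM]; apply/seteqP; split; last first.
  by move=> x Ix; rewrite -(mul1r x); apply: pmul_mem => //; exact: subring1.
by apply: pmul_ind.
Qed.

End Subrings.

(* Inv(B). It is the abelian group of invertible fractional ideals under
   multiplication; the zmodType structure writes it additively. *)
Record inv_ideal (L : fieldType) (B : subring L) := InvIdeal {
  inv_set :> set L;
  inv_setP : invertible B inv_set }.

Section InvGroup.
Variables (L : fieldType) (B : subring L).
Local Notation inv := (inv_ideal B).

Lemma inv_eq (I J : inv) : I = J :> set L -> I = J.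
Proof.
case: I J => I HI [J HJ] /= IJ; subst J; congr InvIdeal.
exact: Prop_irrelevance.
Qed.

Lemma inv1_subproof : invertible B B.
Proof.
have f1 := fractional1 B; split=> //; exists B => //.
by apply: pmul1l; case: f1.
Qed.
Definition inv1 : inv := InvIdeal inv1_subproof.

Lemma invM_subproof (I J : inv) : invertible B (pmul I J).
Proof.
case: I J => I [fI [I' fI' II']] [J [fJ [J' fJ' JJ']]] /=.
split; first exact: fractionalM.
exists (pmul I' J'); first exact: fractionalM.
rewrite pmulA -(pmulA I) (pmulC J) pmulA II' -pmulA JJ'.
by apply: pmul1l; case: (fractional1 B).
Qed.
Definition invM (I J : inv) : inv := InvIdeal (invM_subproof I J).

Lemma invV_ex (I : inv) : {J : inv | pmul J I = B}.
Proof.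
apply: cid; case: I => I [fI [I' fI' II']] /=.
have invI' : invertible B I' by split=> //; exists I => //; rewrite pmulC.
by exists (InvIdeal invI'); rewrite pmulC.
Qed.
Definition invV (I : inv) : inv := sval (invV_ex I).

HB.instance Definition _ := gen_eqMixin inv.
HB.instance Definition _ := gen_choiceMixin inv.

Lemma invMA : associative invM.
Proof. by move=> I J K; apply: inv_eq; exact: pmulA. Qed.
Lemma invMC : commutative invM.
Proof. by move=> I J; apply: inv_eq; exact: pmulC. Qed.
Lemma inv1M : left_id inv1 invM.
Proof. by move=> I; apply: inv_eq; apply: pmul1l; case: (inv_setP I) => -[]. Qed.
Lemma invVM : left_inverse inv1 invV invM.
Proof. by move=> I; apply: inv_eq; rewrite /= /invV; case: (invV_ex I). Qed.

HB.instance Definition _ := GRing.isZmodule.Build inv invMA invMC inv1M invVM.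

Lemma inv0E : (0 : inv) = B :> set L. Proof. by []. Qed.
Lemma invDE (I J : inv) : I + J = pmul I J :> set L. Proof. by []. Qed.

End InvGroup.

Section LocalPicard.
Variables (L : fieldType) (B A : subring L).

Definition subgroup (G : zmodType) (S : set G) :=
  S 0 /\ forall x y, S x -> S y -> S (x - y).

(* Inv_u(B, A), the subgroup generated by the integral unitary ideals *)
Definition invu_pred : {pred inv_ideal B} := fun I =>
  I \in smallest (@subgroup (inv_ideal B))
          [set J | integral B (J : inv_ideal B) /\ unitary A J].

Lemma invu_closed : zmod_closed invu_pred.
Proof.
split; first by rewrite unfold_in inE => S [[]].
move=> I J; rewrite !unfold_in !inE => HI HJ S HS.
by case: (HS) => -[_ SB] _; apply: SB; [exact: HI|exact: HJ].
Qed.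
HB.instance Definition _ :=
  GRing.isZmodClosed.Build (inv_ideal B) invu_pred invu_closed.

Definition invu := {I : inv_ideal B | I \in invu_pred}.
HB.instance Definition _ := SubChoice.on invu.
HB.instance Definition _ := [SubChoice_isSubZmodule of invu by <:].

(* Inv_u(B, A) \cap Princ(B) *)
Definition princu_pred : {pred invu} := fun I => `[< principal B (\val I) >].

Lemma pmul_principal x y : pmul (pmul1 x B) (pmul1 y B) = pmul1 (x * y) B.
Proof.
apply/seteqP; split.
  apply: pmul_ind => [|_ _ [z Bz <-] [w Bw <-]|_ _ [z Bz <-] [w Bw <-]].
  - by exists 0; [exact: subring0|rewrite mulr0].
  - by exists (z + w); [exact: subringD|rewrite mulrDr].
  - by exists (z * w); [exact: subringM|rewrite mulrACA].
move=> _ [z Bz <-]; rewrite -mulrA; apply: pmul_mem; last by exists z.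
by exists 1; [exact: subring1|rewrite mulr1].
Qed.

Lemma pmul1_1 : pmul1 1 B = B.
Proof.
by apply/seteqP; split=> [_ [x Bx <-]|x Bx]; [rewrite mul1r|exists x; rewrite ?mul1r].
Qed.

Lemma princu_closed : zmod_closed princu_pred.
Proof.
split.
  rewrite unfold_in; apply/asboolP; exists 1; split.
  - by apply: sub_quot; exact: subring1.
  - exact: oner_neq0.
  - rewrite raddf0 inv0E; apply/seteqP; split=> [x Bx|_ [x Bx <-]].
      by exists x; rewrite ?mul1r.
    by rewrite mul1r.
move=> I J; rewrite !unfold_in => /asboolP[x [Qx x0 Ix]] /asboolP[y [Qy y0 Jy]].
apply/asboolP; exists (x / y); split.
- apply: subringM => //; case: Qy y0 => a [b [Ba Bb b0 ->]].
  rewrite mulf_eq0 invr_eq0 negb_or => /andP[a0 _].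
  by exists b, a; split; rewrite ?invf_div.
- by rewrite mulf_neq0 ?invr_eq0.
have e : pmul (\val (I - J)) (pmul1 y B) = pmul1 x B.
  by rewrite -Jy -Ix -invDE -raddfD subrK.
rewrite -pmul_principal -e -pmulA pmul_principal divff// pmul1_1 pmulC pmul1l//.
by case: (inv_setP (\val (I - J))) => -[].
Qed.
HB.instance Definition _ :=
  GRing.isZmodClosed.Build invu princu_pred princu_closed.

(* {ideal_quot _} is the library quotient of a zmodType by any subgroup. *)
Definition picu := {ideal_quot princu_pred}.
HB.instance Definition _ := GRing.Zmodule.on picu.

Variable AB : A `<=` B.

Lemma fractional_ext (I : set L) : fractional A I -> fractional B (pmul I B).
Proof.
move=> [[I0 ID IM] IQ [a [Aa a0] aI]]; split.
- split; [exact: pmul0|by move=> x y; exact: pmulD|].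
  move=> b x Bb; move: x.
  apply: (@pmul_ind L I B (fun x => pmul I B (b * x))) => [|z w Hz Hw|x y Ix By].
  + by rewrite mulr0; exact: pmul0.
  + by rewrite mulrDr; exact: pmulD.
  + by rewrite mulrCA; apply: pmul_mem => //; exact: subringM.
- apply: pmul_ind => [|z w|x y Ix By]; [exact: subring0|exact: subringD|].
  apply: subringM; last exact: sub_quot.
  by case: (IQ _ Ix) => u [v [Au Av v0 ->]]; exists u, v; split=> //; exact: AB.
- exists a; first by split=> //; exact: AB.
  move=> _ [z Hz <-]; move: z Hz.
  apply: (@pmul_ind L I B (fun z => B (a * z))) => [|z w Hz Hw|x y Ix By].
  + by rewrite mulr0; exact: subring0.
  + by rewrite mulrDr; exact: subringD.
  + by rewrite mulrA; apply: subringM => //; apply: AB; apply: aI; exists x.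
Qed.

Lemma pmul_ext : pmul A B = B.
Proof.
apply/seteqP; split; last exact: sub_rmulr.
apply: pmul_ind => [|x y|x y Ax By]; [exact: subring0|exact: subringD|].
by apply: subringM => //; exact: AB.
Qed.

Lemma invu_ext (I : inv_ideal A) :
  exists J : invu, (\val J : inv_ideal B) = pmul I B :> set L.
Proof.
case: (inv_setP I) => fI [I' fI' II'].
have BB : pmul B B = B by apply: pmul1l; case: (fractional1 B).
have invIB : invertible B (pmul I B).
  split; [exact: fractional_ext|exists (pmul I' B); first exact: fractional_ext].
  by rewrite pmulA -(pmulA I) (pmulC B I') pmulA II' -pmulA BB pmul_ext.
have [[I0 _ _] IQ [a [Aa a0] aI]] := fI.
have fP x : quot B x -> x != 0 -> fractional B (pmul1 x B).
  move=> Qx x0; split.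
  - split; first by exists 0; [exact: subring0|rewrite mulr0].
      move=> _ _ [z Bz <-] [w Bw <-].
      by exists (z + w); [exact: subringD|rewrite mulrDr].
    move=> b _ Bb [z Bz <-].
    by exists (b * z); [exact: subringM|rewrite mulrCA].
  - by move=> _ [z Bz <-]; apply: subringM => //; exact: sub_quot.
  - case: Qx => u [v [Bu Bv v0 xE]]; exists v => // _ [_ [z Bz <-] <-].
    by rewrite mulrA xE mulrCA divff// mulr1; exact: subringM.
have Qa : quot B a by apply: sub_quot; exact: AB.
have Qai : quot B a^-1.
  by exists 1, a; split=> //; [exact: subring1|exact: AB|rewrite div1r].
have invP : invertible B (pmul1 a B).
  split; first exact: fP.
  exists (pmul1 a^-1 B); first by apply: fP; rewrite ?invr_eq0.
  by rewrite pmul_principal divff// pmul1_1.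
have gen_mem (J : inv_ideal B) :
    integral B J -> unitary A J -> J \in invu_pred.
  by move=> iJ uJ; rewrite unfold_in inE => S [_]; apply.
pose K := InvIdeal invIB; pose P := InvIdeal invP.
suff KI : K \in invu_pred by exists (Sub K KI).
rewrite -(addrK P K); apply: rpredB.
- apply: gen_mem.
    rewrite /integral invDE pmulC.
    apply: pmul_ind => [|z w|_ y [b Bb <-] Iy].
    + exact: subring0.
    + exact: subringD.
    + move: y Iy; apply: (@pmul_ind L I B (fun y => B (a * b * y))).
      * by rewrite mulr0; exact: subring0.
      * by move=> z w Hz Hw; rewrite mulrDr; exact: subringD.
      * move=> x y Ix By; rewrite mulrACA; apply: subringM; last exact: subringM.
        by apply: AB; apply: aI; exists x.
  have [x Ix x0] : exists2 x, I x & x != 0.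
    apply: contrapT => nI; have := subring1 A; rewrite -II'.
    have H : pmul I I' `<=` [set 0].
      apply: pmul_ind => [//|z w /= -> ->|x y Ix _ /=]; first by rewrite addr0.
      have [->|x0] := eqVneq x 0; first by rewrite mul0r.
      by case: nI; exists x.
    by move=> /H /= /eqP; rewrite oner_eq0.
  move=> U; have : (x * a == 0).
    apply/eqP; suff : ((K + P : inv_ideal B) `&` quot A) (x * a) by rewrite U.
    split; last by apply: subringM; [exact: IQ|exact: sub_quot].
    rewrite invDE; apply: pmul_mem.
      by rewrite -(mulr1 x); apply: pmul_mem => //; exact: subring1.
    by exists 1; [exact: subring1|rewrite mulr1].
  by rewrite mulf_eq0 (negPf x0) (negPf a0).
- apply: gen_mem.
    by move=> _ [b Bb <-]; apply: subringM => //; exact: AB.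
  move=> U; have : a == 0; last by rewrite (negPf a0).
  apply/eqP; suff : ((P : set L) `&` quot A) a by rewrite U.
  split; last exact: sub_quot.
  by exists 1; [exact: subring1|rewrite mulr1].
Qed.

(* \iota(Pic(A)), the set of the classes [IB] with I in Inv(A); every IB does
   lie in Inv_u(B, A) by [invu_ext]. *)
Definition extended_pred : {pred picu} := fun c =>
  `[< exists (I : inv_ideal A) (J : invu),
        (\val J : inv_ideal B) = pmul I B :> set L /\ c = (\pi_picu J)%qT >].

Lemma extended_closed : zmod_closed extended_pred.
Proof.
split.
  rewrite unfold_in; apply/asboolP; exists 0, 0; split; last by rewrite raddf0.
  by rewrite raddf0 !inv0E pmul_ext.
move=> c d; rewrite !unfold_in => /asboolP[I [J [JI ->]]] /asboolP[I' [J' [JI' ->]]].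
apply/asboolP; exists (I - I'), (J - J'); split; last by rewrite raddfB.
have BB : pmul B B = B by apply: pmul1l; case: (fractional1 B).
have subB (X : inv_ideal B) : pmul X B = X.
  by rewrite pmulC; apply: pmul1l; case: (inv_setP X) => -[].
have J'V : pmul (\val J') (- \val J' : inv_ideal B) = B.
  by rewrite -invDE subrr inv0E.
have XJ' : pmul (\val (J - J')) (\val J') = \val J.
  by rewrite -invDE -raddfD subrK.
have WI' : pmul (I - I' : inv_ideal A) I' = I by rewrite -invDE subrK.
transitivity (pmul (pmul I B) (- \val J' : inv_ideal B)).
  by rewrite -JI -XJ' -pmulA J'V subB.
transitivity (pmul (pmul (pmul (I - I' : inv_ideal A) B) (\val J'))
                   (- \val J' : inv_ideal B)); last first.
  by rewrite -[LHS]pmulA J'V -pmulA BB.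
have eB (V W : set L) : pmul (pmul V W) B = pmul (pmul V B) (pmul W B).
  by rewrite -!pmulA; congr pmul; rewrite (pmulC W B) pmulA BB.
by congr pmul; rewrite JI' -eB WI'.
Qed.
HB.instance Definition _ :=
  GRing.isZmodClosed.Build picu extended_pred extended_closed.

Definition lpicu := {ideal_quot extended_pred}.
HB.instance Definition _ := GRing.Zmodule.on lpicu.

End LocalPicard.

Record overring (L : fieldType) (B : subring L) := Overring {
  overring_ring :> subring L;
  overringP : B `<=` overring_ring /\ overring_ring `<=` quot B }.

Section Zariski.
Variables (L : fieldType) (B : subring L).
HB.instance Definition _ := gen_eqMixin (overring B).
HB.instance Definition _ := gen_choiceMixin (overring B).
HB.instance Definition _ := @isSubBaseTopological.Build (overring B)
  (set (overring B))
  [set U | exists2 x, quot B x & U = [set T : overring B | (T : subring L) x]]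
  id.
End Zariski.

Section Jaffard.
Variable L : fieldType.
Implicit Types (B T : subring L) (Theta : set (subring L)).

Definition flat_overring B T :=
  T `<=` quot B /\ exists BT : B `<=` T, flat_module (overmod BT).

Definition unit_in T x := T x /\ exists2 y, T y & x * y = 1.

Definition complete_family B Theta := forall I, ideal B I ->
  I = quot B `&` \bigcap_(T in Theta) pmul I T.

Definition independent_family B Theta := forall T T',
  Theta T -> Theta T' -> T <> T' -> pmul T T' = quot B.

Definition locally_finite B Theta := forall x, B x -> x != 0 ->
  finite_set [set T | Theta T /\ ~ unit_in T x].

Definition flat_family B Theta :=
  (forall T, Theta T -> flat_overring B T) /\ ~ Theta (quot B).

Definition jaffard_family B Theta :=
  [/\ flat_family B Theta, complete_family B Theta,
      independent_family B Theta & locally_finite B Theta].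

Definition jaffard_overring B T := exists2 Theta, jaffard_family B Theta & Theta T.

Definition pre_jaffard B Theta :=
  [/\ flat_family B Theta, complete_family B Theta,
      independent_family B Theta & compact [set T : overring B | Theta T]].

Lemma capring_subproof B Theta :
  subring_closed [in quot B `&` \bigcap_(T in Theta) T].
Proof.
apply: subringE => [|x y [Qx Tx] [Qy Ty]|x y [Qx Tx] [Qy Ty]].
- by split=> [|T _]; exact: subring1.
- by split=> [|T TT]; apply: subringB => //; [exact: Tx|exact: Ty].
- by split=> [|T TT]; apply: subringM => //; [exact: Tx|exact: Ty].
Qed.

(* The intersection of Theta, which is Quot(B) when Theta is empty. *)
Definition capring B Theta : subring L := Subring (@capring_subproof B Theta).

End Jaffard.

(* Ordinals are encoded as the elements of an arbitrary well-ordered type W: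
   w stands for the order type of its initial segment {v | v < w}. *)
Section DerivedSequence.
Variables (L : fieldType) (D : subring L) (Theta : set (subring L)).
Variables (d : Order.disp_t) (W : orderType d).
Hypothesis wfW : well_founded (fun v w : W => (v < w)%O).
Implicit Types v w : W.

Definition ord_zero w := forall v, (w <= v)%O.
Definition ord_succ v w := (v < w)%O /\ forall u, (v < u)%O -> (w <= u)%O.
Definition ord_limit w := ~ ord_zero w /\ forall v, ~ ord_succ v w.

Definition derived_ring_of w (N : set (subring L)) : subring L :=
  if `[< ord_zero w >] then D else capring D N.

Definition derived_step w (N : forall v, (v < w)%O -> set (subring L)) :
    set (subring L) :=
  [set T | [\/ ord_zero w /\ Theta T,
               exists v (vw : (v < w)%O), [/\ ord_succ v w, N v vw T
                 & ~ jaffard_overring (derived_ring_of v (N v vw)) T]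
             | ord_limit w /\ forall v (vw : (v < w)%O), N v vw T]].

Definition derived_family : W -> set (subring L) :=
  Fix wfW (fun=> set (subring L)) derived_step.

Definition derived_ring w := derived_ring_of w (derived_family w).

Lemma derived_familyE w :
  derived_family w = derived_step (fun v (_ : (v < w)%O) => derived_family v).
Proof.
rewrite /derived_family Fix_eq// => {}w f g fg.
by congr derived_step; apply: functional_extensionality_dep => v;
   apply: functional_extensionality_dep => vw.
Qed.

Lemma derived_ring0 w : ord_zero w -> derived_ring w = D.
Proof. by move=> w0; rewrite /derived_ring /derived_ring_of asboolT. Qed.

Lemma derived_ring_neq0 w : ~ ord_zero w ->
  derived_ring w = capring D (derived_family w).
Proof. by move=> w0; rewrite /derived_ring /derived_ring_of asboolF. Qed.

Lemma ord_zero_succ v w : ord_zero w -> ~ ord_succ v w.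
Proof. by move=> w0 [vw _]; have := w0 v; rewrite leNgt vw. Qed.

Lemma derived_family0 w : ord_zero w -> derived_family w = Theta.
Proof.
move=> w0; rewrite derived_familyE; apply/seteqP; split=> T /=;
  last by move=> TT; apply: Or31.
case=> [[]//|[v [vw [vsw _ _]]]|[[nw0 _] _]]; last by case: nw0.
by case: (ord_zero_succ w0 vsw).
Qed.

Lemma derived_familyS v w : ord_succ v w -> derived_family w =
  [set T | derived_family v T /\ ~ jaffard_overring (derived_ring v) T].
Proof.
move=> vw; rewrite derived_familyE; apply/seteqP; split=> T /=.
  case=> [[w0 _]|[u [uw [Hu Nu J]]]|[[_ nvw] _]].
  + by case: (ord_zero_succ w0 vw).
  + suff -> : v = u by [].
    have [vu|uv|//] := ltgtP v u.
      by have := vw.2 _ vu; rewrite leNgt uw.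
    by have := Hu.2 _ uv; rewrite leNgt vw.1.
  + by case: (nvw v vw).
by move=> [NT JT]; apply: Or32; exists v, vw.1.
Qed.

Lemma derived_family_lim w : ord_limit w ->
  derived_family w = \bigcap_(v in [set v | (v < w)%O]) derived_family v.
Proof.
move=> wl; rewrite derived_familyE; apply/seteqP; split=> T /=.
  case=> [[w0 _]|[v [_ [vsw _ _]]]|[_ H]].
  + by case: wl.
  + by case: (wl.2 v vsw).
  + by move=> v /= vw; exact: H.
by move=> H; apply: Or33; split=> // v vw; exact: H.
Qed.

End DerivedSequence.

(* The subring f(A) of L, for a domain A mapped into L. *)
Section ImageRing.
Variables (A : idomainType) (L : fieldType) (f : {rmorphism A -> L}).
Lemma imring_subproof : subring_closed [in range f].
Proof.
apply: subringE; first by exists 1; rewrite ?rmorph1.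
- by move=> _ _ [a _ <-] [b _ <-]; exists (a - b); rewrite ?rmorphB.
- by move=> _ _ [a _ <-] [b _ <-]; exists (a * b); rewrite ?rmorphM.
Qed.
Definition imring : subring L := Subring imring_subproof.
End ImageRing.

(* A retract D-algebra R, given by its structure map iota, and D itself are
   both placed in the quotient field of R. *)
Section Embed.
Variables (D R : idomainType) (iota : {rmorphism D -> R}).
Definition frac_ring : subring {fraction R} := imring (@FracField.tofrac R).
Definition base_ring : subring {fraction R} :=
  imring (@FracField.tofrac R \o iota).
Lemma sub_base_frac : base_ring `<=` frac_ring.
Proof. by move=> _ [x _ <-]; exists (iota x). Qed.
End Embed.

(* Main.v *)
Require Import Defs.
From HB Require Import structures.
From mathcomp Require Import all_boot all_order all_algebra finmap.
From mathcomp Require Import mathcomp_extra boolp classical_sets functions.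
From mathcomp Require Import cardinality topology.
From mathcomp Require Import ring.

Set Implicit Arguments.
Unset Strict Implicit.
Unset Printing Implicit Defensive.

Import Order.TTheory GRing.Theory.
Local Open Scope classical_set_scope.
Local Open Scope ring_scope.

(** Let K be the quotient field of D, and write T_w and N^w for the derived
    ring and the derived family at w. The proof rests on additive splittings
    of K. If T is a Jaffard overring of A and C is the intersection of the
    other members of a Jaffard family of A containing T, then T and C meet in
    A and T + C = K ([jaffard_splits]): flatness and independence make the
    traces on A of xS comaximal for different members S, local finiteness
    leaves only finitely many S to consider for each x, and completeness
    recognises the unit ideal. A splitting reduces A to T and C: every A-submodule I is the
    intersection of IT and IC ([splits_meet_ext]), and a pair of invertible
    ideals over RT and RC comes from one over RA ([uinv_glue]). Taking D for R,
    the same statement glues invertible ideals of T and C to one of A.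

    Pseudo-polynomiality says that a unit of RK is an element of K times a
    unit of R ([unit_factor]). Hence a unitary invertible ideal of RA has
    trivial class in the local Picard group exactly when it is JR for an
    invertible ideal J of A ([lpic_class_eq0_extended]), and the theorem
    becomes a statement about ideals.

    A member T of Theta outside N^alpha leaves the derived sequence at a
    unique v < alpha: it lies in N^v and is a Jaffard overring of T_v. Let T'
    be the intersection of the other members of N^v. Then T and T' split K over
    T_v ([leaves_splits]). Writing an element z of T_w as t + s, with t in T
    and s in T', shows that z belongs to every other member of N^v containing
    t. So the open sets given by the elements t cover Theta, together with the
    members of N^w, and by compactness finitely many suffice
    ([derived_ring_finite]). Consequently T_(v+1) is the directed union of the
    rings obtained from T_v by dropping finitely many of the members that leave
    at v ([succ_union]), and T_w is the union of the earlier T_v for w a limit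
    ([limit_union]). Invertible ideals are finitely generated, so they and the
    relations between them already live at some stage of such a union
    ([uinv_descends], [extended_descends]). Well-founded induction along these
    splittings and unions shows that every ideal class over T_w lifts to D
    ([uinv_lift]) and controls the classes that become trivial at w.

    Gluing with the unit ideal over T' lifts each class of LPic_u(RT, T) to a
    class of LPic_u(R, D) that vanishes over T' ([lpic_ext_leaf]). As the group
    is free, the lifts may be chosen additively, and their sum over T is the
    first map f; the second map g is extension of ideals. A nonzero element
    of the direct sum has a component T whose place v of departure is maximal.
    The other components vanish over T, because T contains the rings T'
    attached to them, so the image under f is nonzero over T. For exactness
    in the middle, T' is contained in T_alpha, whence g f = 0; conversely, a
    class that dies at a successor dies after finitely many members are
    dropped, and subtracting the lifts of its components at these members
    makes it die one step earlier. *)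

(** * Flatness through denominators *)

Section QuotientModule.
Variables (A : pzRingType) (M : lmodType A) (S : {pred M}) (S_closed : submod_closed S).

(** The closure proof is an argument so that it can be found from the name of
    the predicate when the quotient is formed. *)
Definition submod_pred of submod_closed S : {pred M} := S.
HB.instance Definition _ := GRing.isZmodClosed.Build M (submod_pred S_closed)
  (GRing.submod_closedB S_closed).
Local Notation P := (submod_pred S_closed).

Definition quotmod := {ideal_quot P}.
HB.instance Definition _ := GRing.Zmodule.on quotmod.

Definition quotmod_proj (m : M) : quotmod := \pi_{ideal_quot P}%qT m.

Lemma quotmod_proj_eq x y : quotmod_proj x = quotmod_proj y <-> x - y \in P.
Proof. by rewrite Quotient.idealrBE; split=> [/eqP|/eqP]. Qed.

Definition quotmod_scale (a : A) (q : quotmod) : quotmod :=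
  quotmod_proj (a *: repr (q : {ideal_quot P})).

Lemma quotmod_scaleE a x : quotmod_scale a (quotmod_proj x) = quotmod_proj (a *: x).
Proof.
apply/quotmod_proj_eq; rewrite -scalerBr; apply: (GRing.subsemimod_closedZ (GRing.submod_closed_semi S_closed)).
by apply/quotmod_proj_eq; rewrite /quotmod_proj reprK.
Qed.

Lemma quotmod_projP (q : quotmod) : exists x, q = quotmod_proj x.
Proof. by exists (repr (q : {ideal_quot P})); rewrite /quotmod_proj reprK. Qed.

Lemma quotmod_projD x y : quotmod_proj (x + y) = quotmod_proj x + quotmod_proj y.
Proof. by rewrite /quotmod_proj raddfD. Qed.

Lemma quotmod_scaleA a b q :
  quotmod_scale a (quotmod_scale b q) = quotmod_scale (a * b) q.
Proof. by have [x ->] := quotmod_projP q; rewrite !quotmod_scaleE scalerA. Qed.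

Lemma quotmod_scale1 : left_id 1 quotmod_scale.
Proof. by move=> q; have [x ->] := quotmod_projP q; rewrite quotmod_scaleE scale1r. Qed.

Lemma quotmod_scaleDr : right_distributive quotmod_scale +%R.
Proof.
move=> a q r; have [x ->] := quotmod_projP q; have [y ->] := quotmod_projP r.
by rewrite -quotmod_projD !quotmod_scaleE scalerDr quotmod_projD.
Qed.

Lemma quotmod_scaleDl q : {morph quotmod_scale^~ q : a b / a + b}.
Proof.
move=> a b; have [x ->] := quotmod_projP q.
by rewrite !quotmod_scaleE scalerDl quotmod_projD.
Qed.

HB.instance Definition _ := GRing.Zmodule_isLmodule.Build A quotmod
  quotmod_scaleA quotmod_scale1 quotmod_scaleDr quotmod_scaleDl.

Lemma quotmod_projZ a x : quotmod_proj (a *: x) = a *: quotmod_proj x.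
Proof. by rewrite -quotmod_scaleE. Qed.

End QuotientModule.

Section TwoGenerated.
Variables (A : comNzRingType) (a b : A).

Definition ideal2_pred : {pred A^o} :=
  fun y : A^o => `[< exists u v : A, y = u * b + v * a :> A >].

Lemma ideal2_closed : submod_closed ideal2_pred.
Proof.
split=> [|k x y].
  by apply/asboolP; exists 0, 0; rewrite !mul0r addr0.
move=> /asboolP[u [v xE]] /asboolP[u' [v' yE]]; apply/asboolP.
exists (k * u + u'), (k * v + v'); change (k * x + y = (k * u + u') * b + (k * v + v') * a :> A).
by rewrite xE yE; ring.
Qed.
HB.instance Definition _ := GRing.isSubmodClosed.Build A A^o ideal2_pred
  (GRing.submod_closed_semi ideal2_closed).

Definition ideal2 := {y : A^o | y \in ideal2_pred}.
HB.instance Definition _ := SubChoice.on ideal2.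
HB.instance Definition _ := [SubChoice_isSubLmodule of ideal2 by <:].
End TwoGenerated.

(** Packages a bilinear function once and for all, over abstract modules where
    the structures involved stay small. *)
Lemma bilinear_fun (A : comNzRingType) (U V W : lmodType A) (b : U -> V -> W) :
  (forall k u u' v, b (k *: u + u') v = k *: b u v + b u' v) ->
  (forall k u v v', b u (k *: v + v') = k *: b u v + b u v') ->
  exists beta : {bilinear U -> V -> W}, forall u v, beta u v = b u v.
Proof.
move=> bl br.
have bil : bilinear_for *:%R *:%R b.
  by split=> [v k u u'|u k v v']; [exact: bl|exact: br].
pose B := bilinear_isBilinear.Build _ _ _ _ _ _ b bil.
pose beta : {bilinear U -> V -> W} := HB.pack b B.
by exists beta.
Qed.

(** The case of the equational criterion for flatness that is needed: from a
    relation bm = an in a flat module M, the element n lies in the submodule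
    spanned by the multiples vt, where v ranges over the second components of
    the syzygies ub + va = 0. The tensor of n and a minus the tensor of m and
    b, over the ideal (a, b), becomes zero over A, hence is zero, and the
    well-defined bilinear map sending (t, ub + va) to the class of vt maps it
    to the class of n. *)
Section FlatRelation.
Variables (A : comNzRingType) (M : lmodType A).
Hypothesis flatM : flat_module M.
Variables (a b : A) (m n : M).
Hypothesis relation : b *: m = a *: n.
Variables (S : {pred M}) (S_closed : submod_closed S).
Hypothesis S_syzygy : forall u v t, u * b + v * a = 0 -> v *: t \in S.

Let coefP (y : ideal2 a b) : {uv : A * A | val y = uv.1 * b + uv.2 * a :> A}.
Proof. by apply: cid; case: y => y /= /asboolP[u [v yE]]; exists (u, v). Qed.

Let co y : A := (sval (coefP y)).2.

Let coP y : exists u : A, val y = u * b + co y * a :> A.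
Proof. by exists (sval (coefP y)).1; rewrite {1}(svalP (coefP y)). Qed.

Let bet (t : M) (y : ideal2 a b) : quotmod S_closed :=
  quotmod_proj S_closed (co y *: t).

Let betE t y (u v : A) : val y = u * b + v * a :> A ->
  bet t y = quotmod_proj S_closed (v *: t).
Proof.
move=> e; have [u0 e0] := coP y; apply/quotmod_proj_eq; rewrite -scalerBl.
apply: (S_syzygy (u := u0 - u)).
by rewrite !mulrBl addrACA -opprD -e0 -e; exact: subrr.
Qed.

Let bet_linl k t t' y : bet (k *: t + t') y = k *: bet t y + bet t' y.
Proof. by rewrite /bet -quotmod_projZ -quotmod_projD scalerDr !scalerA mulrC. Qed.

Let bet_linr k t y y' : bet t (k *: y + y') = k *: bet t y + bet t y'.
Proof.
have [u e] := coP y; have [u' e'] := coP y'.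
rewrite (@betE _ _ (k * u + u') (k * co y + co y')).
  by rewrite /bet -quotmod_projZ -quotmod_projD scalerDl scalerA.
change (k * (val y : A) + (val y' : A) = (k * u + u') * b + (k * co y + co y') * a :> A).
by rewrite e e'; ring.
Qed.

Lemma flat_relation : n \in S.
Proof.
have [beta betaE] := bilinear_fun bet_linl bet_linr.
have genP (u v : A) : ((u * b + v * a : A) : A^o) \in ideal2_pred a b.
  by apply/asboolP; exists u, v.
pose gb : ideal2 a b := exist (fun y => y \in ideal2_pred a b) _ (genP 1 0).
pose ga : ideal2 a b := exist (fun y => y \in ideal2_pred a b) _ (genP 0 1).
pose f (y : ideal2 a b) : A^o := val y.
have f_lin : linear f by [].
pose fL : {linear ideal2 a b -> A^o} :=
  HB.pack f (GRing.isLinear.Build A (ideal2 a b) A^o _ f f_lin).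
have /(_ [:: (- m, gb); (n, ga)]) := flatM (f := fL) val_inj.
have h : tensor0 [seq (p.1, fL p.2) | p <- [:: (- m, gb); (n, ga)]].
  move=> P b2; rewrite !big_cons big_nil addr0 /=.
  have -> : f gb = b *: (1 : A^o) by rewrite /f /= mul1r mul0r addr0 [RHS]mulr1.
  have -> : f ga = a *: (1 : A^o) by rewrite /f /= mul1r mul0r add0r [RHS]mulr1.
  by rewrite linearNl !linearZr_LR -!linearZl_LR relation addNr.
move=> /(_ h) /(_ _ beta).
rewrite !big_cons big_nil addr0 /= !betaE (betE _ (u := 1) (v := 0))//.
rewrite (betE _ (u := 0) (v := 1))// scale0r scale1r -quotmod_projD add0r.
move=> e; rewrite -[n]subr0; apply/(quotmod_proj_eq S_closed).
by rewrite e /quotmod_proj raddf0.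
Qed.
End FlatRelation.

Section Flatness.
Variables (L : fieldType) (A T : subring L).

(** Flatness is used only in this form. With x = a/b, the elements x and 1 of T
    satisfy bx = a1, and ub + va = 0 means vx = -u, so that v is a denominator
    of x. *)
Lemma flat_denominators x : flat_overring A T -> T x ->
  pmul [set d | A d /\ A (d * x)] T 1.
Proof.
move=> [Tq [AT flatT]] Tx; have [a [b [Aa Ab b0 xE]]] := Tq _ Tx.
pose H := [set d | A d /\ A (d * x)].
have inA c : A c -> c \in insub_pred A by rewrite unfold_in inE.
have inT c : T c -> c \in insub_pred T by rewrite unfold_in inE.
have Asub (c : sring A) : A (val c) by have := valP c; rewrite unfold_in inE.
have Tsub (t : sring T) : T (val t) by have := valP t; rewrite unfold_in inE.
pose S : {pred overmod AT} := fun m => `[< pmul H T (val (m : sring T)) >].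
have S_closed : submod_closed S.
  split=> [|k m n]; first by apply/asboolP; exact: pmul0.
  move=> /asboolP hm /asboolP hn; apply/asboolP; apply: pmulD => //.
  move: hm; have : forall z, pmul H T z -> pmul H T (val k * z); last exact.
  apply: (@pmul_ind L H T (fun z => pmul H T (val k * z))) => [|y w hy hw|y w [Ay Axy] Tw].
  - by rewrite mulr0; exact: pmul0.
  - by rewrite mulrDr; exact: pmulD.
  - rewrite mulrA; apply: pmul_mem => //; split; first exact: subringM.
    by rewrite -mulrA; exact: subringM.
pose xT : sring T := Sub x (inT _ Tx).
pose a' : sring A := Sub a (inA _ Aa); pose b' : sring A := Sub b (inA _ Ab).
suff /asboolP : S (1 : sring T) by [].
apply: (@flat_relation _ _ flatT a' b' xT (1 : sring T) _ S S_closed).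
  by apply: (@val_inj _ _ (sring T)); rewrite /= mulr1 xE mulrC divfK.
move=> u v t e; apply/asboolP; apply: pmul_mem; last exact: Tsub.
split; first exact: Asub.
suff -> : val v * x = - val u by apply: subringN; exact: Asub.
have /(congr1 val) /= e' := e.
rewrite xE; apply: (mulIf b0); rewrite -mulrA divfK//.
by apply/eqP; rewrite -subr_eq0 mulNr opprK addrC; apply/eqP.
Qed.
End Flatness.

(** * Products of subsets of the field *)

Section Pmul.
Variable L : fieldType.
Implicit Types (A B T : subring L) (X Y Z I J : set L).

Lemma pmul_mul X Y Z T z w :
  (forall x y, X x -> Y y -> Z (x * y)) ->
  pmul X T z -> pmul Y T w -> pmul Z T (z * w).
Proof.
move=> XYZ + hw; move: z.
apply: (@pmul_ind _ X T (fun z => pmul Z T (z * w))) => [|z z' hz hz'|x t Xx Tt].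
- by rewrite mul0r; exact: pmul0.
- by rewrite mulrDl; exact: pmulD.
move: w hw.
apply: (@pmul_ind _ Y T (fun w => pmul Z T (x * t * w))) => [|w w' hw hw'|y t' Yy Tt'].
- by rewrite mulr0; exact: pmul0.
- by rewrite mulrDr; exact: pmulD.
by rewrite mulrACA; apply: pmul_mem; [exact: XYZ|exact: subringM].
Qed.

Lemma submodule_subring A B : A `<=` B -> submodule A B.
Proof.
move=> AB; split; [exact: subring0|by move=> x y; exact: subringD|].
by move=> a b Aa Bb; apply: subringM => //; exact: AB.
Qed.

Lemma submodule_restrict A B I : A `<=` B -> submodule B I -> submodule A I.
Proof. by move=> AB [I0 ID IM]; split=> // b x Ab; apply: IM; exact: AB. Qed.

Lemma submodule_pmul B X Y : submodule B Y -> submodule B (pmul X Y).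
Proof.
move=> [Y0 YD YM]; split; [exact: pmul0|by move=> x y; exact: pmulD|].
move=> b + Bb; apply: (@pmul_ind _ X Y (fun z => pmul X Y (b * z))) => [|z w hz hw|x y Xx Yy].
- by rewrite mulr0; exact: pmul0.
- by rewrite mulrDr; exact: pmulD.
- by rewrite mulrCA; apply: pmul_mem => //; exact: YM.
Qed.

Lemma submodule_pmulr B X : submodule B (pmul X B).
Proof. by apply: submodule_pmul; exact: submodule_subring. Qed.

Lemma submoduleI B I J : submodule B I -> submodule B J -> submodule B (I `&` J).
Proof.
move=> [I0 ID IM] [J0 JD JM]; split=> //.
  by move=> x y [Ix Jx] [Iy Jy]; split; [exact: ID|exact: JD].
by move=> b x Bb [Ix Jx]; split; [exact: IM|exact: JM].
Qed.

Lemma submoduleB B I x y : submodule B I -> I x -> I y -> I (x - y).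
Proof.
move=> [I0 ID IM] Ix Iy; apply: ID => //; rewrite -mulN1r; apply: IM => //.
by apply: subringN; exact: subring1.
Qed.

Lemma pmul_sub B I X Y : submodule B I ->
  (forall x y, X x -> Y y -> I (x * y)) -> pmul X Y `<=` I.
Proof. by move=> [I0 ID IM] XY; apply: pmul_ind. Qed.

Lemma pmulB B I : submodule B I -> pmul I B = I.
Proof. by rewrite pmulC; exact: pmul1l. Qed.

Lemma pmul_subring A B : A `<=` B -> pmul B A = B.
Proof. by move=> AB; apply: pmulB; exact: submodule_subring. Qed.

Lemma pmulAC X Y Z : pmul (pmul X Y) Z = pmul (pmul X Z) Y.
Proof. by rewrite -!pmulA (pmulC Y). Qed.

Lemma sub_pmulr X B : X `<=` pmul X B.
Proof. by move=> x Xx; rewrite -(mulr1 x); apply: pmul_mem => //; exact: subring1. Qed.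

Lemma rmul_id A B : A `<=` B -> rmul A B = B.
Proof. by move=> AB; apply: subring_eq; exact: pmul_ext. Qed.

Lemma quot_overring A B : A `<=` B -> B `<=` quot A -> quot B = quot A :> set L.
Proof.
move=> AB BK; apply/seteqP; split=> [_ [a [b [Ba Bb b0 ->]]]|_ [a [b [Aa Ab b0 ->]]]].
  apply: subringM; first exact: BK.
  have [c [e [Ac Ae e0 bE]]] := BK _ Bb.
  have c0 : c != 0 by apply: contraNneq b0 => c0; rewrite bE c0 mul0r.
  by exists e, c; split=> //; rewrite bE invf_div.
by exists a, b; split=> //; exact: AB.
Qed.

Lemma quotV A x : quot A x -> quot A x^-1.
Proof.
move=> [a [b [Aa Ab b0 ->]]]; have [->|a0] := eqVneq a 0.
  by rewrite mul0r invr0; exact: subring0.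
by exists b, a; split=> //; rewrite invf_div.
Qed.

End Pmul.

(** * Jaffard overrings split the quotient field *)

Section Split.
Variable L : fieldType.
Implicit Types (A T C S : subring L) (K : set L).

(** The additive form of independence of T and C over A: equivalently K/A is
    the direct sum of T/A and C/A. It is stronger than TC = K, is inherited
    by enlarging C among rings with the same trace on T, and makes elementwise
    gluing possible. *)
Record splits K A T C : Prop := Splits {
  splits_subl : A `<=` T;
  splits_subr : A `<=` C;
  splits_ltop : T `<=` K;
  splits_rtop : C `<=` K;
  splits_meet : T `&` C `<=` A;
  splits_sum : forall z, K z -> exists t s, [/\ T t, C s & z = t + s] }.

Lemma splits_sym K A T C : splits K A T C -> splits K A C T.
Proof.
move=> [h1 h2 h3 h4 h5 h6]; split=> // [z [? ?]|z /h6[t [s [Tt Cs ->]]]].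
  by apply: h5.
by exists s, t; rewrite addrC.
Qed.

(** The conductor of finitely many elements contains the product of their
    conductors, and each of these generates the unit ideal of T. *)
Lemma flat_common_denominators A T (s : seq L) : flat_overring A T ->
  (forall x, x \in s -> T x) ->
  pmul [set d | A d /\ forall x, x \in s -> A (d * x)] T 1.
Proof.
move=> fl; elim: s => [|x s IH] Ts.
  by rewrite -(mulr1 1); apply: pmul_mem; last exact: subring1; split => //; exact: subring1.
rewrite -(mulr1 1).
apply: (pmul_mul _ (flat_denominators fl (Ts x (mem_head _ _))) (IH _)); last first.
  by move=> y ys; apply: Ts; rewrite in_cons ys orbT.
move=> d e [Ad Adx] [Ae Aes]; split; first exact: subringM.
move=> y; rewrite in_cons => /orP[/eqP->|ys].
  by rewrite mulrAC; exact: subringM.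
by rewrite -mulrA; apply: subringM => //; exact: Aes.
Qed.

(** Write 1/x as a sum of products of elements of S' and S. A common
    denominator in A of the factors from S then lies in xS'. *)
Lemma independent_comaximal A S S' x : flat_overring A S -> A `<=` S' ->
  pmul S' S = quot A -> A x -> x != 0 -> pmul [set a | A a /\ S' (a / x)] S 1.
Proof.
move=> fl AS' SS' Ax x0.
have : quot A x^-1 by apply: quotV; exact: sub_quot.
rewrite -SS' => -[s [Hs xE]].
have := @flat_common_denominators A S [seq p.2 | p <- s] fl _.
case=> [y /mapP[p ps ->]|s' [Hs' E]]; first by case: (Hs p ps).
exists s'; split=> // p ps'; have [[Ad Ads] Sp] := Hs' p ps'; split=> //; split=> //.
rewrite xE mulr_sumr big_seq; apply: (big_ind S') => [|y z|q qs].
- exact: subring0.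
- exact: subringD.
rewrite mulrCA; apply: subringM; first by case: (Hs q qs).
by apply: AS'; apply: Ads; apply/mapP; exists q.
Qed.

Lemma comaximal_meet A S x (s : seq {classic subring L}) :
  (forall S' : {classic subring L}, S' \in s -> A `<=` (S' : subring L) /\
     pmul [set a | A a /\ (S' : subring L) (a / x)] S 1) ->
  pmul [set a | A a /\ forall S' : {classic subring L}, S' \in s -> (S' : subring L) (a / x)] S 1.
Proof.
elim: s => [|S0 s IH] Hs.
  by rewrite -(mulr1 1); apply: pmul_mem; last exact: subring1; split => //; exact: subring1.
rewrite -(mulr1 1).
have [AS0 h0] := Hs S0 (mem_head _ _).
have Hs' (S' : {classic subring L}) : S' \in s -> A `<=` (S' : subring L) /\
     pmul [set a | A a /\ (S' : subring L) (a / x)] S 1.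
  by move=> ss; apply: Hs; rewrite in_cons ss orbT.
apply: (pmul_mul _ h0 (IH Hs')).
move=> a b [Aa Sa] [Ab Sb]; split; first exact: subringM.
move=> S'; rewrite in_cons => /orP[/eqP->|ss].
  by rewrite mulrAC; apply: subringM => //; exact: AS0.
by rewrite -mulrA; apply: subringM; [apply: (Hs' _ ss).1|exact: Sb].
Qed.

(** It suffices to write 1 = u + v with u in both A and xT and v in both A and
    xC, for each nonzero x of A, where C is the intersection of the other
    members. By completeness this can be checked after extension to each member
    S. If S is not T, the part in xT is already the unit ideal. If S = T, only the
    finitely many members in which x is not a unit constrain the part in xC. *)
Lemma jaffard_splits A T : jaffard_overring A T ->
  exists C, splits (quot A) A T C.
Proof.
move=> [Phi [[flPhi nK] compl indep lf] PT].
pose C := capring A [set S | Phi S /\ S <> T]; exists C.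
have AP S : Phi S -> A `<=` S by move=> /flPhi[_ []].
have AC : A `<=` C.
  by move=> x Ax; split=> [|S [PS _]]; [exact: sub_quot|exact: AP].
have meetA z : quot A z -> (forall S, Phi S -> S z) -> A z.
  move=> Qz Sz; have idA : ideal A A by split=> //; exact: submodule_subring.
  rewrite (compl A idA); split=> // S PS; exact/sub_rmulr/Sz.
have key x : A x -> x != 0 -> exists u v,
    [/\ A u, A v, T (u / x), C (v / x) & u + v = 1].
  move=> Ax x0.
  pose J1 := [set a | A a /\ T (a / x)]; pose J2 := [set a | A a /\ C (a / x)].
  pose J := [set z | exists u v, [/\ J1 u, J2 v & z = u + v]].
  have J1J : J1 `<=` J.
    move=> u Ju; exists u, 0; split; rewrite ?addr0//.
    by split; rewrite ?mul0r; exact: subring0.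
  have J2J : J2 `<=` J.
    move=> u Ju; exists 0, u; split; rewrite ?add0r//.
    by split; rewrite ?mul0r; exact: subring0.
  have idJ : ideal A J.
    split; last by move=> _ [u [v [[Au _] [Av _] ->]]]; exact: subringD.
    split.
    - by apply: J1J; split; rewrite ?mul0r; exact: subring0.
    - move=> _ _ [u [v [[Au Tu] [Av Cv] ->]]] [u' [v' [[Au' Tu'] [Av' Cv'] ->]]].
      exists (u + u'), (v + v'); split; last by rewrite addrACA.
        by split; rewrite ?mulrDl; exact: subringD.
      by split; rewrite ?mulrDl; apply: subringD.
    - move=> a _ Aa [u [v [[Au Tu] [Av Cv] ->]]].
      exists (a * u), (a * v); split; last by rewrite mulrDr.
        split; first exact: subringM.
        by rewrite -mulrA; apply: subringM => //; exact: AP.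
      split; first exact: subringM.
      by rewrite -mulrA; apply: subringM => //; exact: AC.
  suff : J 1.
    by move=> [u [v [[Au Tu] [Av Cv] ->]]]; exists u, v.
  rewrite (compl _ idJ); split; first exact: subring1.
  move=> S PS; have [SE|ST] := pselect (S = T); last first.
    have J1S : pmul J1 S `<=` pmul J S by exact: pmulS.
    apply: J1S; apply: (independent_comaximal (flPhi _ PS) (AP _ PT)) => //.
    by apply: indep => // e; exact: ST.
  rewrite SE; have /(@finite_seqP {classic subring L})[s sE] := lf x Ax x0.
  pose s' : seq {classic subring L} := [seq S <- s | `[< S <> T >]].
  have sP (S' : {classic subring L}) : S' \in s -> Phi S' /\ ~ unit_in S' x.
    move=> ss; have : [set T0 | Phi T0 /\ ~ unit_in T0 x] S' by rewrite sE.
    by [].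
  have s'P (S' : {classic subring L}) : Phi S' -> S' <> T -> ~ unit_in S' x -> S' \in s'.
    move=> PS' ne nu; rewrite mem_filter; apply/andP; split; first exact/asboolP.
    by have : [set` s] S' by rewrite -sE.
  have := @comaximal_meet A T x s' _; case=> [S'|ss [Hss E]].
    rewrite mem_filter => /andP[/asboolP ne /sP[PS' _]]; split; first exact: AP.
    by apply: independent_comaximal => //; [exact: flPhi|exact: AP|exact: indep].
  exists ss; split=> // p /Hss[[Ap Sp] Tp]; split=> //; apply: J2J; split=> //.
  split; first by apply: subringM; [|apply: quotV]; exact: sub_quot.
  move=> S' [PS' ne]; have [[S'x [y S'y xy]]|nu] := pselect (unit_in S' x).
    apply: subringM; first exact: AP.
    suff -> : x^-1 = y by [].
    by apply: (mulfI x0); rewrite xy divff.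
  by apply: Sp; exact: s'P.
split.
- exact: AP.
- exact: AC.
- by have [] := flPhi _ PT.
- by move=> z [].
- move=> z [Tz [Qz Cz]]; apply: meetA => // S PS.
  by have [->//|ST] := pselect (S = T); exact: Cz.
- move=> _ [a [b [Aa Ab b0 ->]]]; have [u [v [Au Av Tu Cv uv]]] := key b Ab b0.
  exists (a * (u / b)), (a * (v / b)); split.
  + by apply: subringM => //; exact: AP.
  + by apply: subringM => //; exact: AC.
  + by rewrite -mulrDr -mulrDl uv mul1r.
Qed.

End Split.

(** * Invertible ideals commensurable with the base domain *)

Section Uinv.
Variables (L : fieldType) (D : subring L).
Implicit Types (A B T C R : subring L) (I J X Y : set L).

(** For A between D and K and A contained in B, these are the elements of
    Inv_u(B, A), in a symmetric form: I and its inverse J both become integral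
    after multiplication by a nonzero d in D, and then d lies in both. *)
Definition uinv B I := submodule B I /\ exists J,
  [/\ submodule B J, pmul I J = B
    & exists d, [/\ D d, d != 0, forall x, I x -> B (d * x)
                  & forall x, J x -> B (d * x)]].

Lemma uinv_mem B I : D `<=` B -> uinv B I -> exists e, [/\ D e, e != 0 & I e].
Proof.
move=> DB [sI [J [sJ IJ [d [Dd d0 dI dJ]]]]]; exists d; split=> //.
have := subring1 B; rewrite -IJ -[d]mulr1; move: (1 : L).
apply: (@pmul_ind _ I J (fun z => I (d * z))) => [|z w|x y Ix Jy]; have [I0 ID IM] := sI.
- by rewrite mulr0.
- by rewrite mulrDr; exact: ID.
- by rewrite mulrCA mulrC; apply: (IM) => //; exact: dJ.
Qed.

Lemma uinv_ext B B' I : B `<=` B' -> uinv B I -> uinv B' (pmul I B').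
Proof.
move=> BB' [sI [J [sJ IJ [d [Dd d0 dI dJ]]]]]; split; first exact: submodule_pmulr.
exists (pmul J B'); split; first exact: submodule_pmulr.
  by rewrite pmulA (pmulAC I) IJ -pmulA (@pmul_subring _ B' B')// pmul_ext.
have H (X : set L) : (forall x, X x -> B (d * x)) ->
    forall x, pmul X B' x -> B' (d * x).
  move=> dX; apply: (@pmul_ind _ X B' (fun z => B' (d * z))) => [|z w hz hw|x y Xx By].
  - by rewrite mulr0; exact: subring0.
  - by rewrite mulrDr; exact: subringD.
  - by rewrite mulrA; apply: subringM => //; apply: BB'; exact: dX.
by exists d; split=> //; exact: H.
Qed.

Lemma uinv_self B : uinv B B.
Proof.
have sB : submodule B B by exact: submodule_subring.
split=> //; exists B; split=> //; first exact: pmulB.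
by exists 1; split; rewrite ?oner_neq0//; [exact: subring1|move=> x; rewrite mul1r..].
Qed.

Lemma uinv_sym B I : uinv B I -> exists J, uinv B J /\ pmul I J = B.
Proof.
move=> [sI [J [sJ IJ [d [Dd d0 dI dJ]]]]]; exists J; split=> //; split=> //.
by exists I; split=> //; [rewrite pmulC|exists d].
Qed.

Section Glue.
Variables (A T C : subring L).
Hypotheses (DA : D `<=` A) (sp : splits (quot D) A T C).

(** For a product ic with c = p/q, take x = q: if u is in A and in qT, then uc
    is in both T and C, hence in A. *)
Lemma splits_denominator I z : submodule A I -> pmul I C z ->
  exists x, [/\ D x, x != 0 & forall u, A u -> T (u / x) -> I (u * z)].
Proof.
case: sp => AT AC TK CK TC _.
have DT : D `<=` T by exact: subset_trans DA AT.
move=> [I0 ID IM]; move: z; apply: pmul_ind => [|z w|i c Ii Cc].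
- by exists 1; split; [exact: subring1|exact: oner_neq0|move=> u _ _; rewrite mulr0].
- move=> [x [Dx x0 xz]] [y [Dy y0 yz]]; exists (x * y).
  split; [exact: subringM|by rewrite mulf_neq0|move=> u Au Tu].
  rewrite mulrDr; apply: ID; [apply: xz|apply: yz] => //.
    have -> : u / x = y * (u / (x * y)) by field; rewrite ?x0 ?y0.
    by apply: subringM => //; exact: DT.
  have -> : u / y = x * (u / (x * y)) by field; rewrite ?x0 ?y0.
  by apply: subringM => //; exact: DT.
- have [p [q [Dp Dq q0 cE]]] := CK _ Cc; exists q; split=> // u Au Tu.
  rewrite mulrCA mulrC; apply: (IM) => //; apply: TC; split.
    by rewrite cE mulrCA; apply: subringM => //; exact: DT.
  by apply: subringM => //; exact: AC.
Qed.
End Glue.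

(** Choose the denominators x and y of z from both sides and split 1/(xy):
    this writes 1 as the sum of an element of xT and an element of yC, both in
    A, and each of them multiplies z into I. *)
Lemma splits_meet_ext A T C I z : D `<=` A -> splits (quot D) A T C ->
  submodule A I -> pmul I T z -> pmul I C z -> I z.
Proof.
move=> DA sp sI IT IC.
have [y [Dy y0 yI]] := splits_denominator DA (splits_sym sp) sI IT.
have [x [Dx x0 xI]] := splits_denominator DA sp sI IC.
case: sp => AT AC TK CK TC sum.
have DT : D `<=` T by exact: subset_trans DA AT.
have DC : D `<=` C by exact: subset_trans DA AC.
have [t [s [Tt Cs e]]] : exists t s, [/\ T t, C s & (x * y)^-1 = t + s].
  by apply: sum; apply: quotV; apply: sub_quot; exact: subringM.
have e1 : x * y * t + x * y * s = 1 by rewrite -mulrDr -e divff// mulf_neq0.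
have Txyt : T (x * y * t) by apply: subringM => //; apply: DT; exact: subringM.
have Cxys : C (x * y * s) by apply: subringM => //; apply: DC; exact: subringM.
have Axyt : A (x * y * t).
  apply: TC; split=> //; have -> : x * y * t = 1 - x * y * s by rewrite -e1 addrK.
  by apply: subringB => //; exact: subring1.
have Axys : A (x * y * s).
  apply: TC; split=> //; have -> : x * y * s = 1 - x * y * t by rewrite -e1 addrAC subrr add0r.
  by apply: subringB => //; exact: subring1.
have [I0 ID IM] := sI.
rewrite -[z]mul1r -e1 mulrDl; apply: ID.
  apply: xI => //; have -> : x * y * t / x = y * t by field.
  by apply: subringM => //; exact: DT.
apply: yI => //; have -> : x * y * s / y = x * s by field.
by apply: subringM => //; exact: DC.
Qed.

(** K = mT + nC. Up to a factor of K, the quotient m/n may be taken to be p/q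
    with p and q in D, and pT + pC = K is contained in pT + C. *)
Lemma splits_scaled A T C m n z : D `<=` A -> splits (quot D) A T C ->
  quot D m -> m != 0 -> quot D n -> n != 0 -> quot D z ->
  exists t s, [/\ T t, C s & z = m * t + n * s].
Proof.
move=> DA [AT AC TK CK TC sum] Km m0 Kn n0 Kz.
have DT : D `<=` T by exact: subset_trans DA AT.
have DC : D `<=` C by exact: subset_trans DA AC.
have [p [q [Dp Dq q0 mnE]]] : quot D (m / n) by apply: subringM => //; exact: quotV.
have p0 : p != 0.
  apply: contraNneq m0 => p0; have : m / n == 0 by rewrite mnE p0 mul0r.
  by rewrite mulf_eq0 invr_eq0 (negPf n0) orbF.
have [t [s [Tt Cs e]]] : exists t s, [/\ T t, C s & z / (n * p) = t + s].
  by apply: sum; apply: subringM => //; apply: quotV; apply: subringM => //; exact: sub_quot.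
exists (q * t), (p * s); split.
- by apply: subringM => //; exact: DT.
- by apply: subringM => //; exact: DC.
have mE : m = p / q * n by rewrite -mnE divfK.
have -> : z = n * p * (z / (n * p)) by field; rewrite ?p0 ?n0.
by rewrite e mE; field.
Qed.

Section GlueIdeals.
Variables (R A T C : subring L).
Hypotheses (DA : D `<=` A) (DR : D `<=` R) (sp : splits (quot D) A T C).

(** Both I and J meet K, in e and f say. The elements of I lie in RK, so
    K = eT + fC splits them into an element of eRT and one of J, the latter
    being also in I. It remains to see that e itself comes from the
    intersection. *)
Lemma uinv_glue_extl I J : uinv (rmul R T) I -> uinv (rmul R C) J ->
  pmul (I `&` J) T = I.
Proof.
move=> uI uJ.
have [AT AC TK CK TC sum] := sp.
have DT : D `<=` T by exact: subset_trans DA AT.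
have DRT : D `<=` rmul R T by move=> x /DR Rx; exact: sub_pmulr.
have DRC : D `<=` rmul R C by move=> x /DR Rx; exact: sub_pmulr.
have [e [De e0 Ie]] := uinv_mem DRT uI; have [f [Df f0 Jf]] := uinv_mem DRC uJ.
have TRT : T `<=` rmul R T := @sub_rmulr _ R T.
have CRC : C `<=` rmul R C := @sub_rmulr _ R C.
have RRT : R `<=` rmul R T := @sub_pmulr _ R T.
have RRC : R `<=` rmul R C := @sub_pmulr _ R C.
have [sI [_ [_ _ [d [Dd d0 dI _]]]]] := uI; have [sJ _] := uJ.
have [I0 ID IM] := sI; have [J0 JD JM] := sJ.
have sIT := submodule_restrict TRT sI.
have sIJ : submodule R (I `&` J).
  by apply: submoduleI; [exact: submodule_restrict RRT sI|exact: submodule_restrict RRC sJ].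
have sIJT : submodule T (pmul (I `&` J) T) := @submodule_pmulr _ _ _.
have sIJR : submodule R (pmul (I `&` J) T) by rewrite pmulC; exact: submodule_pmul.
apply/seteqP; split; first by apply: (pmul_sub sIT) => x t [Ix _] Tt; rewrite mulrC; case: sIT => _ _; exact.
have eIJT : pmul (I `&` J) T e.
  (* With 1 = pt + ps, both ep = fq and eps lie in the intersection. *)
  have [p [q [Dp Dq q0 epE]]] : quot D (f / e).
    by apply: subringM; [|apply: quotV]; exact: sub_quot.
  have p0 : p != 0.
    apply: contraNneq f0 => p0; have : f / e == 0 by rewrite epE p0 mul0r.
    by rewrite mulf_eq0 invr_eq0 (negPf e0) orbF.
  have epfq : e * p = f * q.
    have -> : f = f / e * e by rewrite divfK.
    by rewrite epE; field.
  have [t [s [Tt Cs E]]] : exists t s, [/\ T t, C s & p^-1 = t + s].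
    by apply: sum; apply: quotV; exact: sub_quot.
  have -> : e = e * p * t + e * (p * s) by rewrite -mulrA -mulrDr -mulrDr -E divff// mulr1.
  have Tps : T (p * s).
    have -> : p * s = 1 - p * t by rewrite -[1](divff p0) E mulrDr addrAC subrr add0r.
    by apply: subringB; [exact: subring1|apply: subringM => //; exact: DT].
  apply: pmulD; first apply: pmul_mem => //.
    split; first by rewrite mulrC; apply: (IM) => //; exact: DRT.
    by rewrite epfq mulrC; apply: (JM) => //; exact: DRC.
  apply: sub_pmulr; split; first by rewrite mulrC; apply: (IM) => //; exact: TRT.
  rewrite mulrA epfq mulrC; apply: (JM); last by rewrite mulrC; apply: (JM) => //; exact: DRC.
  exact: CRC.
have decomp y : pmul R (quot D) y ->
    exists y1 y2, [/\ pmul (pmul R T) [set e] y1, J y2 & y = y1 + y2].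
  move: y; apply: pmul_ind => [|z w [z1 [z2 [h1 h2 ->]]] [w1 [w2 [h3 h4 ->]]]|r k Rr Kk].
  - by exists 0, 0; split; rewrite ?addr0//; exact: pmul0.
  - exists (z1 + w1), (z2 + w2); split; [exact: pmulD|exact: JD|by rewrite addrACA].
  - have [t [s [Tt Cs ->]]] : exists t s, [/\ T t, C s & k = e * t + f * s].
      by apply: (splits_scaled DA sp) => //; exact: sub_quot.
    exists (r * t * e), (r * (f * s)); split.
    + by apply: pmul_mem => //; exact: pmul_mem.
    + apply: (JM); first exact: RRC.
      by rewrite mulrC; apply: (JM) => //; exact: CRC.
    + by ring.
have eIJ y : pmul (pmul R T) [set e] y -> pmul (I `&` J) T y.
  move: y; apply: (pmul_sub (B := T) sIJT) => z _ hz ->.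
  rewrite mulrC; move: z hz.
  apply: (@pmul_ind _ R T (fun z => pmul (I `&` J) T (e * z))) => [|z w|r t Rr Tt].
  + by rewrite mulr0; exact: pmul0.
  + by rewrite mulrDr; exact: pmulD.
  + by rewrite mulrC -mulrA; case: sIJR => _ _; apply=> //; case: sIJT => _ _; apply.
move=> y Iy.
have [y1 [y2 [h1 Jy2 yE]]] : exists y1 y2, [/\ pmul (pmul R T) [set e] y1, J y2 & y = y1 + y2].
  apply: decomp; have := dI _ Iy; move=> /(pmulS (@subset_refl _ R) TK) h.
  have -> : y = d^-1 * (d * y) by rewrite mulKf.
  have [_ _] : submodule (quot D) (pmul R (quot D)) by exact: submodule_pmulr.
  by apply=> //; apply: quotV; exact: sub_quot.
rewrite yE; apply: pmulD; first exact: eIJ.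
apply: sub_pmulr; split=> //.
have -> : y2 = y - y1 by rewrite yE addrAC subrr add0r.
apply: (submoduleB sI) => //.
have : pmul (I `&` J) T `<=` I by apply: (pmul_sub sIT) => x t [Ix _] Tt; rewrite mulrC; case: sIT => _ _; exact.
by apply; exact: eIJ.
Qed.

End GlueIdeals.

(** The inverse of the intersection is the intersection of the inverses: the
    product becomes the unit ideal over T and over C, and is recovered from
    these two extensions. *)
Lemma uinv_glue R A T C I1 I2 : D `<=` A -> D `<=` R -> splits (quot D) A T C ->
  uinv (rmul R T) I1 -> uinv (rmul R C) I2 ->
  exists I, [/\ uinv (rmul R A) I, pmul I T = I1 & pmul I C = I2].
Proof.
move=> DA DR sp u1 u2.
have [J1 [v1 IJ1]] := uinv_sym u1; have [J2 [v2 IJ2]] := uinv_sym u2.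
have gT X Y : uinv (rmul R T) X -> uinv (rmul R C) Y -> pmul (X `&` Y) T = X.
  by move=> uX uY; exact: (uinv_glue_extl DA DR sp uX uY).
have gC X Y : uinv (rmul R T) X -> uinv (rmul R C) Y -> pmul (X `&` Y) C = Y.
  by move=> uX uY; rewrite setIC; exact: (uinv_glue_extl DA DR (splits_sym sp) uY uX).
exists (I1 `&` I2); split; [|exact: gT|exact: gC].
have [AT AC _ _ _ _] := sp.
have RAT : rmul R A `<=` rmul R T by exact: pmulS.
have RAC : rmul R A `<=` rmul R C by exact: pmulS.
have meetRA z : rmul R T z -> rmul R C z -> rmul R A z.
  move=> RTz RCz; apply: (splits_meet_ext DA sp); first exact: submodule_pmulr.
    by rewrite /= -pmulA pmul_ext.
  by rewrite /= -pmulA pmul_ext.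
have sub X Y : uinv (rmul R T) X -> uinv (rmul R C) Y -> submodule (rmul R A) (X `&` Y).
  by move=> [sX _] [sY _]; apply: submoduleI;
    [exact: submodule_restrict sX|exact: submodule_restrict sY].
have IJT : pmul (pmul (I1 `&` I2) (J1 `&` J2)) T = rmul R T.
  rewrite -pmulA gT// -(pmul1l (submodule_restrict (@sub_rmulr _ R T) v1.1)).
  by rewrite pmulA gT.
have IJC : pmul (pmul (I1 `&` I2) (J1 `&` J2)) C = rmul R C.
  rewrite -pmulA gC// -(pmul1l (submodule_restrict (@sub_rmulr _ R C) v2.1)).
  by rewrite pmulA gC.
have sIJ : submodule (rmul R A) (pmul (I1 `&` I2) (J1 `&` J2)).
  by apply: submodule_pmul; exact: sub.
split; first exact: sub.
exists (J1 `&` J2); split; first exact: sub.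
- apply/seteqP; split=> z.
    move=> h; apply: meetRA; first by rewrite -IJT; exact: sub_pmulr.
    by rewrite -IJC; exact: sub_pmulr.
  move=> RAz; rewrite -[z]mulr1; case: (sIJ) => _ _; apply=> //.
  apply: (splits_meet_ext DA sp).
  + by apply: submodule_restrict sIJ; exact: sub_rmulr.
  + by rewrite IJT; exact: subring1.
  + by rewrite IJC; exact: subring1.
have den X Y : uinv (rmul R T) X -> uinv (rmul R C) Y ->
    exists d, [/\ D d, d != 0 & forall x, (X `&` Y) x -> rmul R A (d * x)].
  move=> [_ [_ [_ _ [d [Dd d0 dX _]]]]] [_ [_ [_ _ [d' [Dd' d'0 dY _]]]]].
  exists (d * d'); split; [exact: subringM|by rewrite mulf_neq0|move=> x [Xx Yx]].
  have DB B : D `<=` rmul R B by move=> y /DR; exact: sub_pmulr.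
  apply: meetRA; last by rewrite -mulrA; apply: subringM; [exact: DB|exact: dY].
  by rewrite mulrAC; apply: subringM; [exact: dX|exact: DB].
have [d [Dd d0 dI]] := den _ _ u1 u2; have [d' [Dd' d'0 dJ]] := den _ _ v1 v2.
have DRA : D `<=` rmul R A by move=> y /DR; exact: sub_pmulr.
exists (d * d'); split; [exact: subringM|by rewrite mulf_neq0|move=> x hx..].
  by rewrite mulrAC; apply: subringM; [exact: dI|exact: DRA].
by rewrite -mulrA; apply: subringM; [exact: DRA|exact: dJ].
Qed.
End Uinv.

(** * Descending finitely generated data along directed unions *)

Section Eventually.
Variables (L : fieldType) (A' : subring L).
Implicit Types (A : subring L) (P Q : subring L -> Prop) (X Y : set L).

(** P holds for every subring containing some finite subset of A'. When A' is
    a directed union, such a subring can be found among the members of the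
    union. *)
Definition eventually P := exists s : seq L, (forall z, z \in s -> A' z) /\
  forall A, (forall z, z \in s -> A z) -> P A.

Lemma eventually_always P : (forall A, P A) -> eventually P.
Proof. by move=> h; exists [::]. Qed.

Lemma eventually_imp P Q : (forall A, P A -> Q A) -> eventually P -> eventually Q.
Proof. by move=> h [s [sA' Ps]]; exists s; split=> // A /Ps/h. Qed.

Lemma eventually_and P Q : eventually P -> eventually Q ->
  eventually (fun A => P A /\ Q A).
Proof.
move=> [s [sA' Ps]] [t [tA' Qt]]; exists (s ++ t); split=> [z|A stA].
  by rewrite mem_cat => /orP[/sA'|/tA'].
by split; [apply: Ps => z zs|apply: Qt => z zt]; apply: stA; rewrite mem_cat ?zs ?zt ?orbT.
Qed.

Lemma eventually_all (T : eqType) (P : T -> subring L -> Prop) (s : seq T) :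
  (forall x, x \in s -> eventually (P x)) ->
  eventually (fun A => forall x, x \in s -> P x A).
Proof.
elim: s => [|x s IH] h; first by apply: eventually_always.
have h1 := h x (mem_head _ _); have h2 := IH (fun y ys => h y (mem_behead (s := x :: s) ys)).
apply: eventually_imp (eventually_and h1 h2) => A [PxA PsA] y.
by rewrite in_cons => /orP[/eqP->|/PsA].
Qed.

Lemma eventually_in z : A' z -> eventually (fun A => A z).
Proof.
move=> A'z; exists [:: z]; split=> [y|A h]; first by rewrite mem_seq1 => /eqP->.
by apply: h; rewrite mem_seq1.
Qed.

Lemma eventually_pmul X z : pmul X A' z -> eventually (fun A => pmul X A z).
Proof.
move=> [s [Hs ->]].
have h : eventually (fun A => forall p, p \in s -> A p.2).
  by apply: eventually_all => p /Hs[_ A'p]; exact: eventually_in.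
apply: eventually_imp h => A h; exists s; split=> // p ps.
by split; [case: (Hs p ps)|exact: h].
Qed.

End Eventually.

Section Spread.
Variables (L : fieldType) (D R : subring L).
Hypothesis DR : D `<=` R.
Implicit Types (A B T C : subring L) (I J X Y : set L).

Local Notation uinv := (uinv D).

Lemma pmul_rmul_l A A' X : A `<=` A' -> pmul (pmul X (rmul R A)) A' = pmul X (rmul R A').
Proof. by move=> AA'; rewrite /= -!pmulA pmul_ext. Qed.

(** Writing 1 as a sum of products xy with x in I and y in its inverse, the
    elements x generate I, and they generate an invertible ideal over RA as
    soon as RA contains the products of all x and y and the multiples by d
    that bound them. *)
Lemma uinv_descends A' I : D `<=` A' -> uinv (rmul R A') I ->
  exists X : seq L, I = pmul [set` X] (rmul R A') /\
    eventually A' (fun A => D `<=` A -> uinv (rmul R A) (pmul [set` X] (rmul R A))).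
Proof.
move=> DA' [sI [J [sJ IJ [d [Dd d0 dI dJ]]]]].
have [s [Hs s1]] : pmul I J 1 by rewrite IJ; exact: subring1.
pose X := [seq p.1 | p <- s]; pose Y := [seq p.2 | p <- s].
have XI x : x \in X -> I x by move=> /mapP[p /Hs[Ip _] ->].
have YJ y : y \in Y -> J y by move=> /mapP[p /Hs[_ Jp] ->].
have BJ b : pmul I J b -> rmul R A' b by rewrite IJ.
exists X; split.
  apply/seteqP; split=> [z Iz|]; last first.
    by apply: (pmul_sub sI) => x b /= /XI Ix Bb; rewrite mulrC; case: sI => _ _; exact.
  exists [seq (p.1, p.2 * z) | p <- s]; split; last first.
    by rewrite big_map /= -[LHS]mul1r s1 mulr_suml; apply: eq_bigr => p _; rewrite mulrA.
  move=> _ /mapP[p ps ->] /=; split; first by apply/mapP; exists p.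
  by apply: BJ; rewrite mulrC; apply: pmul_mem => //; case: (Hs p ps).
have ev1 : eventually A' (fun A => forall x, x \in X -> forall y, y \in Y -> rmul R A (x * y)).
  apply: (@eventually_all _ _ _ (fun x A => forall y, y \in Y -> rmul R A (x * y))) => x Xx.
  apply: (@eventually_all _ _ _ (fun y A => rmul R A (x * y))) => y Yy.
  by apply: eventually_pmul; apply: BJ; apply: pmul_mem; [exact: XI|exact: YJ].
have ev2 : eventually A' (fun A => forall x, x \in X -> rmul R A (d * x)).
  apply: (@eventually_all _ _ _ (fun x A => rmul R A (d * x))) => x Xx.
  by apply: eventually_pmul; apply: dI; exact: XI.
have ev3 : eventually A' (fun A => forall x, x \in Y -> rmul R A (d * x)).
  apply: (@eventually_all _ _ _ (fun x A => rmul R A (d * x))) => x Xx.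
  by apply: eventually_pmul; apply: dJ; exact: YJ.
apply: eventually_imp (eventually_and ev1 (eventually_and ev2 ev3)).
move=> A [XY [dX dY]] DA; set B := rmul R A.
have BB : pmul B B = B by rewrite (@pmul_subring _ B B).
split; first exact: submodule_pmulr.
exists (pmul [set` Y] B); split; first exact: submodule_pmulr.
  rewrite pmulA (pmulAC [set` X]) -pmulA BB.
  apply/seteqP; split.
    have sB : submodule B B by exact: submodule_subring.
    apply: (pmul_sub sB) => z b + Bb.
    suff h : pmul [set` X] [set` Y] `<=` B by move=> /h Bz; exact: subringM.
    by apply: (pmul_sub sB) => x y /= Xx Yy; exact: XY.
  move=> z Bz; rewrite -[z]mul1r; apply: pmul_mem => //.
  exists s; split=> // p ps.
  by split; apply/mapP; exists p.
have den Z : (forall x, x \in Z -> B (d * x)) -> forall x, pmul [set` Z] B x -> B (d * x).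
  move=> dZ; apply: (@pmul_ind _ [set` Z] B (fun x => B (d * x))) => [|z w|x y Zx By].
  - by rewrite mulr0; exact: subring0.
  - by rewrite mulrDr; exact: subringD.
  - by rewrite mulrA; apply: subringM => //; exact: dZ.
by exists d; split=> //; exact: den.
Qed.

(** For I a unitary invertible ideal of R, this is the vanishing of its image in
    LPic_u(RA, A), as shown in [lpic_ext_eq0]. *)
Definition extended I A := exists J, uinv A J /\ pmul I A = pmul J R.

Lemma extended_mono I A A' : A `<=` A' -> extended I A -> extended I A'.
Proof.
move=> AA' [J [uJ IA]]; exists (pmul J A'); split; first exact: uinv_ext uJ.
by rewrite pmulAC -IA -pmulA pmul_ext.
Qed.

(** The ideals of T and C inducing I glue to an ideal J of A, and JR and IA
    have the same extensions to T and to C. *)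
Lemma extended_splits I A T C : D `<=` A -> splits (quot D) A T C ->
  extended I T -> extended I C -> extended I A.
Proof.
move=> DA sp [J1 [u1 IT]] [J2 [u2 IC]].
have [AT AC _ _ _ _] := sp.
have DT : D `<=` T by exact: subset_trans DA AT.
have DC : D `<=` C by exact: subset_trans DA AC.
have := uinv_glue (R := D) (I1 := J1) (I2 := J2) DA (@subset_refl _ D) sp.
rewrite !rmul_id// => /(_ u1 u2)[J [uJ JT JC]]; exists J; split=> //.
have sJR : submodule A (pmul J R) by rewrite pmulC; apply: submodule_pmul; case: uJ.
have sIA : submodule A (pmul I A) by exact: submodule_pmulr.
have eT : pmul (pmul I A) T = pmul (pmul J R) T.
  by rewrite -pmulA pmul_ext// pmulAC JT.
have eC : pmul (pmul I A) C = pmul (pmul J R) C.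
  by rewrite -pmulA pmul_ext// pmulAC JC.
apply/seteqP; split=> z hz.
  by apply: (splits_meet_ext DA sp sJR); [rewrite -eT|rewrite -eC]; exact: sub_pmulr.
by apply: (splits_meet_ext DA sp sIA); [rewrite eT|rewrite eC]; exact: sub_pmulr.
Qed.

End Spread.

(** An equality IA' = JR is witnessed by finitely many memberships, those of the
    generators of each side in the other. *)
Lemma extended_descends (L : fieldType) (D R : subring L) (A' : subring L) (I : set L) :
  D `<=` R -> D `<=` A' -> uinv D R I -> extended D R I A' ->
  eventually A' (fun A => D `<=` A -> extended D R I A).
Proof.
move=> DR DA' uI [J [uJ IA]].
have := @uinv_descends _ D D A' J DA'; rewrite rmul_id// => /(_ uJ)[X [JE evX]].
have := @uinv_descends _ D R D I (@subset_refl _ D).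
have -> : rmul R D = R by apply: subring_eq; exact: pmul_subring.
move=> /(_ uI)[G [IE _]].
have XJ x : x \in X -> pmul J R x.
  by move=> Xx; apply: sub_pmulr; rewrite JE; exact: sub_pmulr.
have ev1 : eventually A' (fun A => forall x, x \in X -> pmul I A x).
  apply: (@eventually_all _ _ _ (fun x A => pmul I A x)) => x Xx.
  by apply: eventually_pmul; rewrite IA; exact: XJ.
have ev2 : eventually A' (fun A => forall g, g \in G -> pmul (pmul [set` X] R) A g).
  apply: (@eventually_all _ _ _ (fun g A => pmul (pmul [set` X] R) A g)) => g Gg.
  apply: eventually_pmul; rewrite pmulAC -JE -IA; apply: sub_pmulr.
  by rewrite IE; exact: sub_pmulr.
apply: eventually_imp (eventually_and evX (eventually_and ev1 ev2)).
move=> A [uX [XI GX]] DA; exists (pmul [set` X] A); split.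
  by have := uX DA; rewrite rmul_id.
have sR : submodule R (pmul I A) by rewrite pmulC; apply: submodule_pmul; case: uI.
have sA : submodule A (pmul I A) by exact: submodule_pmulr.
have sR' : submodule R (pmul (pmul [set` X] A) R) by exact: submodule_pmulr.
have sA' : submodule A (pmul (pmul [set` X] A) R) by rewrite pmulAC; exact: submodule_pmulr.
apply/seteqP; split.
  apply: (pmul_sub sA') => i a + Aa; rewrite IE.
  rewrite mulrC => hi; case: sA' => _ _; apply=> //; move: i hi.
  apply: (pmul_sub sR') => g r /= /GX Gg Rr; rewrite mulrC; case: sR' => _ _; apply=> //.
  by rewrite pmulAC.
apply: (pmul_sub sR) => z r + Rr; rewrite mulrC => hz; case: sR => _ _; apply=> //.
move: z hz; apply: (pmul_sub sA) => x a /= /XI Xx Aa.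
by rewrite mulrC; case: sA => _ _; exact.
Qed.

(** * Splittings and unions in the derived sequence *)

Section ZariskiOpen.
Variables (L : fieldType) (B : subring L).
Lemma base_overringP : B `<=` B /\ B `<=` quot B.
Proof. by split=> //; exact: sub_quot. Qed.
(* The description of compactness by covers concerns pointed spaces. *)
HB.instance Definition _ := isPointed.Build (overring B) (Overring base_overringP).

Lemma zariski_open x : quot B x -> open [set T : overring B | (T : subring L) x].
Proof.
move=> Qx. set U := (X in open X).
exists [set U]; last first.
  by apply/seteqP; split=> [T [_ -> //]|T UT]; exists U.
move=> _ ->; have := @finI_from1 _ _ [set U | exists2 x, quot B x & U = [set T : overring B | (T : subring L) x]] id U.
by apply; exists x.
Qed.

(** Used with an element x T of T so chosen that membership of x T in another
    member S of the family carries information about S. *)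
Lemma zariski_finite_cover (Theta : set (subring L)) (x : subring L -> L) :
  (forall T, Theta T -> B `<=` T /\ T `<=` quot B) ->
  compact [set T : overring B | Theta T] ->
  (forall T, Theta T -> T (x T)) ->
  exists s : seq {classic subring L}, (forall T : {classic subring L}, T \in s -> Theta T) /\
    forall S, Theta S -> exists2 T : {classic subring L}, T \in s & (S : subring L) (x T).
Proof.
move=> BT cpt Tx; move: cpt; rewrite compact_cover.
move=> /(_ (overring B) [set T : overring B | Theta T]
  (fun T => [set S : overring B | (S : subring L) (x T)])) [T TT||F FT cov].
- by apply: zariski_open; apply: (BT _ TT).2; exact: Tx.
- by move=> T TT; exists T => //; exact: Tx.
exists (map (fun T : overring B => (T : subring L) : {classic subring L}) (enum_fset F)); split=> [_ /mapP[T TF ->]|S TS].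
  by have := FT _ TF; rewrite inE.
have [T TF Sx] := cov (Overring (BT _ TS)) TS.
by exists (T : subring L) => //; apply/mapP; exists T.
Qed.
End ZariskiOpen.

Section Derived.
Variables (L : fieldType) (D : subring L) (Theta : set (subring L)).
Hypothesis Theta_pj : pre_jaffard D Theta.
Variables (d : Order.disp_t) (W : orderType d).
Hypothesis wfW : well_founded (fun v w : W => (v < w)%O).
Implicit Types (v w u : W) (S T : subring L).

Local Notation N := (derived_family D Theta wfW).
Local Notation Dw := (derived_ring D Theta wfW).
Local Notation K := (quot D).

Lemma ord_cases w : [\/ ord_zero w, exists v, ord_succ v w | ord_limit w].
Proof.
have [?|nz] := pselect (ord_zero w); first exact: Or31.
have [?|ns] := pselect (exists v, ord_succ v w); first exact: Or32.
by apply: Or33; split=> // v vw; apply: ns; exists v.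
Qed.

Lemma ord_succ_le v w u : ord_succ v w -> (u < w)%O -> (u <= v)%O.
Proof. by move=> [vw h] uw; rewrite leNgt; apply/negP => /h; rewrite leNgt uw. Qed.

Lemma family_overring T : Theta T -> D `<=` T /\ T `<=` K.
Proof. by case: Theta_pj => -[fl _] _ _ _ /fl[TK [DT _]]. Qed.

Lemma derived_familyW w T : N w T -> Theta T.
Proof.
elim/(well_founded_ind wfW): w T => w IH T.
have [w0|[v vw]|wl] := ord_cases w.
- by rewrite derived_family0.
- by rewrite (derived_familyS _ _ _ vw) => -[NT _]; exact: (IH v vw.1).
- rewrite derived_family_lim// => h.
  have [v /negP vw] : exists v, ~ (w <= v)%O by apply: contrapT => nv; apply: wl.1 => v; apply: contrapT => h'; apply: nv; exists v.
  by rewrite -ltNge in vw; exact: IH (h v vw).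
Qed.

Lemma derived_family_anti v w : (v <= w)%O -> N w `<=` N v.
Proof.
elim/(well_founded_ind wfW): w v => w IH v; rewrite le_eqVlt => /orP[/eqP->//|vw] T.
have [w0|[u uw]|wl] := ord_cases w.
- by have := w0 v; rewrite leNgt vw.
- rewrite (derived_familyS _ _ _ uw) => -[NT _].
  by apply: (IH u uw.1 v) => //; exact: ord_succ_le uw vw.
- by rewrite derived_family_lim// => h; exact: h.
Qed.

Lemma derived_ringE w z : Dw w z <-> K z /\ forall T, N w T -> T z.
Proof.
have [w0|nz] := pselect (ord_zero w); last first.
  by rewrite derived_ring_neq0.
rewrite derived_ring0// derived_family0//; split=> [Dz|[Kz Tz]].
  by split=> [|T TT]; [exact: sub_quot|apply: (family_overring TT).1].
have [_ compl _ _] := Theta_pj.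
have idD : ideal D D by split=> //; exact: submodule_subring.
rewrite (compl D idD); split=> // T TT.
by rewrite pmul_ext; [exact: Tz|exact: (family_overring TT).1].
Qed.

Lemma base_sub_derived w : D `<=` Dw w.
Proof.
move=> z Dz; apply/derived_ringE; split=> [|T /derived_familyW TT]; first exact: sub_quot.
exact: (family_overring TT).1.
Qed.

Lemma derived_sub_quot w : Dw w `<=` K.
Proof. by move=> z /derived_ringE[]. Qed.

Lemma derived_sub_member w T : N w T -> Dw w `<=` T.
Proof. by move=> NT z /derived_ringE[_]; apply. Qed.

Lemma derived_ring_mono v w : (v <= w)%O -> Dw v `<=` Dw w.
Proof.
move=> vw z /derived_ringE[Kz Tz]; apply/derived_ringE; split=> // T /(derived_family_anti vw).
exact: Tz.
Qed.

Definition leaves v T := N v T /\ jaffard_overring (Dw v) T.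

Definition others v T := capring D [set S | N v S /\ S <> T].

(** At the first index whose family omits T, which can be neither zero nor a
    limit, T has just been discarded as a Jaffard overring. *)
Lemma leaves_exists w T : Theta T -> ~ N w T -> exists v, (v < w)%O /\ leaves v T.
Proof.
elim/(well_founded_ind wfW): w => w IH TT NT.
have [w0|[v vw]|wl] := ord_cases w.
- by case: NT; rewrite derived_family0.
- have [NvT|/(IH v vw.1 TT)[u [uv lu]]] := pselect (N v T); last first.
    by exists u; split=> //; exact: lt_trans uv vw.1.
  exists v; split; first exact: vw.1.
  split=> //; apply: contrapT => nJ; apply: NT.
  by rewrite (derived_familyS _ _ _ vw).
- have [v [vw NvT]] : exists v, (v < w)%O /\ ~ N v T.
    apply: contrapT => h; apply: NT; rewrite derived_family_lim// => v /= vw.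
    by apply: contrapT => NvT; apply: h; exists v.
  have [u [uv lu]] := IH v vw TT NvT.
  by exists u; split=> //; exact: lt_trans uv vw.
Qed.

(** A Jaffard family of T_v provides a splitting with some C. For another
    member S of N^v, independence gives ST = K, so C is contained in both ST
    and SC, hence in S. Thus C is contained in the intersection of the other
    members, which may replace it. *)
Lemma leaves_splits v T : leaves v T -> splits K (Dw v) T (others v T).
Proof.
move=> [NT /jaffard_splits[C]].
have DA := @base_sub_derived v; have AK := @derived_sub_quot v.
rewrite (quot_overring DA AK) => sp; have [AT AC TK CK TC sum] := sp.
have [_ _ indep _] := Theta_pj.
have CO : C `<=` others v T.
  move=> z Cz; split=> [|S [NS ST]]; first exact: CK.
  apply: (splits_meet_ext DA sp (I := S)).
  - by apply: submodule_subring; exact: derived_sub_member.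
  - by rewrite (indep _ _ (derived_familyW NS) (derived_familyW NT) ST); exact: CK.
  - exact: sub_rmulr.
split=> //.
- exact: subset_trans AC CO.
- by move=> z [].
- move=> z [Tz [Kz Oz]]; apply/derived_ringE; split=> // S NS.
  by have [->//|ST] := pselect (S = T); exact: Oz.
- by move=> z /sum[t [s [Tt /CO Os ->]]]; exists t, s.
Qed.

Lemma others_sub v T S : N v S -> S <> T -> others v T `<=` S.
Proof. by move=> NS ST z [_]; apply. Qed.

(** Cover Theta by the sets of overrings containing z, around the members of
    N^w, and by those containing t, around a member T leaving at v, where
    z = t + s with t in T and s in the other members of N^v. If S is another
    member of N^v containing t, it contains z. *)
Lemma derived_ring_finite w z : Dw w z ->
  exists s : seq ({classic subring L} * W),
    (forall p, p \in s -> (p.2 < w)%O /\ leaves p.2 p.1) /\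
    forall S, Theta S ->
      (forall p, p \in s -> N p.2 S /\ S <> p.1) -> S z.
Proof.
move=> /derived_ringE[Kz Nz].
have /choice[f fP] : forall T, exists p : L * W, Theta T -> [/\ T p.1, N w T -> p.1 = z &
    ~ N w T -> [/\ (p.2 < w)%O, leaves p.2 T &
      forall S, S p.1 -> N p.2 S -> S <> T -> S z]].
  move=> T; have [TT|nT] := pselect (Theta T); last by exists (0, w).
  have [NT|NT] := pselect (N w T); first by exists (z, w) => _; split=> //=; exact: Nz.
  have [v [vw lv]] := leaves_exists TT NT.
  have [AT AO TK OK TO sum] := leaves_splits lv.
  have [t [s [Tt Os zE]]] := sum _ Kz.
  exists (t, v) => _; split=> //= _; split=> // S St NS ST.
  by rewrite zE; apply: subringD => //; exact: others_sub NS ST _ Os.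
have [_ _ _ cpt] := Theta_pj.
have [|s0 [s0T s0cov]] := @zariski_finite_cover _ D Theta (fun T => (f T).1) family_overring cpt.
  by move=> T /fP[].
exists (map (fun T : {classic subring L} => (T, (f T).2))
  [seq T : {classic subring L} <- s0 | `[< ~ N w T >]]); split.
  move=> _ /mapP[T + ->]; rewrite mem_filter => /andP[/asboolP NT /s0T TT] /=.
  by have [_ _ /(_ NT)[]] := fP _ TT.
move=> S TS hS; have [T Ts ST] := s0cov S TS.
have TT := s0T _ Ts; have [_ fz fN] := fP _ TT.
have [/fz fzE|NT] := pselect (N w T); first by rewrite -fzE.
have [_ _] := fN NT; apply=> //.
  by have [] := hS (T, (f T).2) (map_f _ _); [rewrite mem_filter Ts andbT; exact/asboolP|].
by have [] := hS (T, (f T).2) (map_f _ _); [rewrite mem_filter Ts andbT; exact/asboolP|].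
Qed.

Lemma ord_succ_ex u v : (u < v)%O -> exists w, ord_succ u w /\ (w <= v)%O.
Proof.
elim/(well_founded_ind wfW): v => v IH uv.
have [[x [ux xv]]|h] := pselect (exists x, (u < x)%O /\ (x < v)%O).
  by have [w [uw wx]] := IH x xv ux; exists w; split=> //; exact: le_trans wx (ltW xv).
exists v; split=> //; split=> // x ux; rewrite leNgt; apply/negP => xv.
by apply: h; exists x.
Qed.

Lemma leaves_out u v T : leaves u T -> (u < v)%O -> ~ N v T.
Proof.
move=> [NT JT] /ord_succ_ex[w [uw wv]] /(derived_family_anti wv).
by rewrite (derived_familyS _ _ _ uw) => -[].
Qed.

Lemma limit_below w (s : seq W) : ord_limit w -> (forall u, u \in s -> (u < w)%O) ->
  exists v, (v < w)%O /\ forall u, u \in s -> (u < v)%O.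
Proof.
move=> [nz ns]; elim: s => [|u s IH] sw.
  have [v /negP vw] : exists v, ~ (w <= v)%O.
    by apply: contrapT => nv; apply: nz => v; apply: contrapT => h; apply: nv; exists v.
  by exists v; split=> //; rewrite ltNge.
have [v [vw sv]] : exists v, (v < w)%O /\ forall u, u \in s -> (u < v)%O.
  by apply: IH => x xs; apply: sw; rewrite in_cons xs orbT.
have uw : (u < w)%O by apply: sw; rewrite in_cons eqxx.
have [x [ux xw]] : exists x, (u < x)%O /\ (x < w)%O.
  apply: contrapT => h; apply: (ns u); split=> // x ux.
  by rewrite leNgt; apply/negP => xw; apply: h; exists x.
exists (Order.max v x); split; first by rewrite gt_max vw xw.
move=> y; rewrite in_cons lt_max => /orP[/eqP->|/sv->//].
by rewrite ux orbT.
Qed.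

Definition strip v (F : seq {classic subring L}) :=
  capring D [set S | N v S /\ ((S : {classic subring L}) \in F) = false].

Lemma strip0 v : strip v [::] = Dw v.
Proof.
apply: subring_eq; apply/seteqP; split=> z.
  by move=> [Kz Tz]; apply/derived_ringE; split=> // T NT; exact: Tz.
by move=> /derived_ringE[Kz Tz]; split=> // T [NT _]; exact: Tz.
Qed.

Lemma strip_mem v (T : {classic subring L}) F : T \in F -> strip v (T :: F) = strip v F.
Proof.
move=> TF; apply: subring_eq; apply/seteqP; split=> z [Kz Sz]; split=> // S [NS SF]; apply: Sz; split=> //.
  by rewrite in_cons SF; case: eqP => // ST; rewrite ST TF in SF.
by move: SF; rewrite in_cons => /norP[_ /negbTE].
Qed.

Lemma strip_anti v F F' : {subset F <= F'} -> strip v F `<=` strip v F'.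
Proof.
move=> FF z [Kz Sz]; split=> // S [NS SF]; apply: Sz; split=> //.
by apply/negP => /FF; rewrite SF.
Qed.

Lemma base_sub_strip v F : D `<=` strip v F.
Proof. by apply: subset_trans (@base_sub_derived v) _; rewrite -strip0; exact: strip_anti. Qed.

(** One member is dropped at a time: the ring obtained after dropping T contains
    the intersection of the members of N^v other than T. *)
Lemma strip_splits v (T : {classic subring L}) F : leaves v T -> (T \in F) = false ->
  splits K (strip v F) T (strip v (T :: F)).
Proof.
move=> lT TF; have [AT AO TK OK TO sum] := leaves_splits lT.
have OS : others v T `<=` strip v (T :: F).
  move=> z [Kz Oz]; split=> // S [NS]; rewrite in_cons => /norP[/eqP ST _].
  exact: Oz.
split=> //.
- by move=> z [_]; apply; split=> //; case: lT.
- by apply: strip_anti => S SF; rewrite in_cons SF orbT.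
- by move=> z [].
- move=> z [Tz [Kz Sz]]; split=> // S [NS SF].
  have [->//|ST] := pselect (S = T); apply: Sz; split=> //.
  by rewrite in_cons SF orbF; apply/eqP.
- by move=> z /sum[t [s [Tt /OS Os ->]]]; exists t, s.
Qed.

Lemma strip_sub v w F : ord_succ v w ->
  (forall T : {classic subring L}, T \in F -> leaves v T) -> strip v F `<=` Dw w.
Proof.
move=> vw lF z [Kz Sz]; apply/derived_ringE; split=> // T NT; apply: Sz.
split; first by apply: derived_family_anti NT; exact: ltW vw.1.
by apply/negP => /lF lT; exact: leaves_out lT vw.1 NT.
Qed.

(** An exceptional member of [derived_ring_finite] that is still in N^v can only
    leave at v itself. *)
Lemma succ_union v w (s : seq L) : ord_succ v w -> (forall z, z \in s -> Dw w z) ->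
  exists F, (forall T : {classic subring L}, T \in F -> leaves v T) /\
    forall z, z \in s -> strip v F z.
Proof.
move=> vw; elim: s => [|z s IH] sw; first by exists [::].
have [F [lF sF]] := IH (fun y ys => sw y (mem_behead (s := z :: s) ys)).
have [t [lt tz]] := derived_ring_finite (sw z (mem_head _ _)).
pose G := [seq T <- map fst t | `[< leaves v T >]].
exists (G ++ F); split=> [T|y].
  by rewrite mem_cat mem_filter => /orP[/andP[/asboolP]|/lF].
rewrite in_cons => /orP[/eqP->|ys]; last first.
  by apply: (strip_anti _ (sF _ ys)) => T TF; rewrite mem_cat TF orbT.
split=> [|S [NS SGF]]; first by have /derived_ringE[] := sw z (mem_head _ _).
apply: tz => [|p pt]; first exact: derived_familyW NS.
have [pw lp] := lt p pt; have pv := ord_succ_le vw pw.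
split; first exact: derived_family_anti NS.
move=> Sp; move: SGF; rewrite mem_cat => /norP[/negP SG _]; apply: SG.
rewrite mem_filter Sp map_f// andbT; apply/asboolP.
move: pv lp; rewrite le_eqVlt => /orP[/eqP->//|pv] lp.
by case: (leaves_out lp pv); rewrite -Sp.
Qed.

(** Beyond the indices at which the exceptional members of
    [derived_ring_finite] leave, no exception remains. *)
Lemma limit_union w (s : seq L) : ord_limit w -> (forall z, z \in s -> Dw w z) ->
  exists v, (v < w)%O /\ forall z, z \in s -> Dw v z.
Proof.
move=> wl; elim: s => [|z s IH] sw.
  by have [|v [vw _]] := @limit_below w [::] wl => //; exists v.
have [v [vw sv]] := IH (fun y ys => sw y (mem_behead (s := z :: s) ys)).
have [t [lt tz]] := derived_ring_finite (sw z (mem_head _ _)).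
have [|x [xw tx]] := @limit_below w (map snd t) wl.
  by move=> _ /mapP[p /lt[pw _] ->].
exists (Order.max v x); split; first by rewrite gt_max vw xw.
move=> y; rewrite in_cons => /orP[/eqP->|ys]; last first.
  by apply: derived_ring_mono (sv _ ys); rewrite le_max lexx.
apply: (@derived_ring_mono x); first by rewrite le_max lexx orbT.
apply/derived_ringE; split=> [|S NS]; first by have /derived_ringE[] := sw z (mem_head _ _).
apply: tz => [|p pt]; first exact: derived_familyW NS.
have px : (p.2 < x)%O by apply: tx; exact: map_f.
split; first by apply: derived_family_anti NS; exact: ltW.
by move=> Sp; apply: (leaves_out (lt p pt).2 px); rewrite -Sp.
Qed.

End Derived.

(** * Ideals along the derived sequence *)

Section DerivedIdeals.
Variables (L : fieldType) (D R : subring L) (Theta : set (subring L)).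
Hypothesis DR : D `<=` R.
Hypothesis Theta_pj : pre_jaffard D Theta.
Variables (d : Order.disp_t) (W : orderType d).
Hypothesis wfW : well_founded (fun v w : W => (v < w)%O).
Implicit Types (v w u : W) (S T : subring L) (F : seq {classic subring L}).

Local Notation N := (derived_family D Theta wfW).
Local Notation Dw := (derived_ring D Theta wfW).
Local Notation K := (quot D).
Local Notation leaves := (leaves D Theta wfW).
Local Notation others := (others D Theta wfW).
Local Notation strip := (strip D Theta wfW).
Local Notation uinv := (uinv D).
Local Notation extended := (extended D R).

(** Undo the dropping of each member T by gluing with the unit ideal over RT. *)
Lemma uinv_lift_strip v F I' : (forall T : {classic subring L}, T \in F -> leaves v T) ->
  uinv (rmul R (strip v F)) I' ->
  exists I, uinv (rmul R (Dw v)) I /\ pmul I (strip v F) = I'.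
Proof.
elim: F I' => [|T F IH] I' lF uI.
  exists I'; rewrite -(strip0 Theta_pj); split=> //.
  by apply: pmulB; apply: submodule_restrict uI.1; exact: sub_rmulr.
have lF' (S : {classic subring L}) : S \in F -> leaves v S.
  by move=> SF; apply: lF; rewrite in_cons SF orbT.
case TF : (T \in F); first by move: uI; rewrite strip_mem//; exact: IH.
have sp := strip_splits Theta_pj (lF T (mem_head _ _)) TF.
have DS := @base_sub_strip _ _ _ Theta_pj _ _ wfW v F.
have [J [uJ JT JI]] := uinv_glue DS DR sp (uinv_self D (rmul R T)) uI.
have [J' [uJ' J'J]] := IH J lF' uJ.
exists J'; split=> //; rewrite -JI -J'J -pmulA pmul_ext//.
by case: sp.
Qed.

Lemma uinv_lift w I' : uinv (rmul R (Dw w)) I' ->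
  exists I, uinv R I /\ pmul I (Dw w) = I'.
Proof.
elim/(well_founded_ind wfW): w I' => w IH I' uI.
have sI : submodule (Dw w) I' by apply: submodule_restrict uI.1; exact: sub_rmulr.
have [w0|[v vw]|wl] := ord_cases w.
- exists I'; split; last exact: pmulB.
  by move: uI; rewrite derived_ring0// (_ : rmul R D = R)//; apply: subring_eq; exact: pmul_subring.
- have DA := @base_sub_derived _ _ _ Theta_pj _ _ wfW w.
  have [X [IX [s [sw evX]]]] := uinv_descends DA uI.
  have [F [lF sF]] := succ_union Theta_pj vw sw.
  have uX := evX _ sF (@base_sub_strip _ _ _ Theta_pj _ _ wfW v F).
  have [J [uJ JX]] := uinv_lift_strip lF uX.
  have [I [uI0 IJ]] := IH v vw.1 J uJ.
  have SD := strip_sub Theta_pj vw lF.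
  have DS : Dw v `<=` strip v F by rewrite -(strip0 Theta_pj); exact: strip_anti.
  exists I; split=> //; rewrite IX -(pmul_rmul_l R _ SD) -JX -IJ.
  by rewrite -!pmulA (pmul_ext SD) (pmul_ext (subset_trans DS SD)).
- have DA := @base_sub_derived _ _ _ Theta_pj _ _ wfW w.
  have [X [IX [s [sw evX]]]] := uinv_descends DA uI.
  have [v [vw sv]] := limit_union Theta_pj wl sw.
  have uX := evX _ sv (@base_sub_derived _ _ _ Theta_pj _ _ wfW v).
  have [I [uI0 IJ]] := IH v vw _ uX.
  have SD := derived_ring_mono Theta_pj (wfW := wfW) (ltW vw).
  by exists I; split=> //; rewrite IX -(pmul_rmul_l R _ SD) -IJ -pmulA (pmul_ext SD).
Qed.

(** Glue I1 with the unit ideal over the intersection of the other members. *)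
Lemma uinv_leaf v T I1 : leaves v T -> uinv (rmul R T) I1 ->
  exists I, [/\ uinv R I, pmul I T = I1 & extended I (others v T)].
Proof.
move=> lT uI1; have sp := leaves_splits Theta_pj lT; have [AT AC _ _ _ _] := sp.
have DA := @base_sub_derived _ _ _ Theta_pj _ _ wfW v.
have [J [uJ JT JC]] := uinv_glue DA DR sp uI1 (uinv_self D (rmul R (others v T))).
have [I [uI IJ]] := uinv_lift uJ; exists I; split=> //.
  by rewrite -JT -IJ -pmulA (pmul_ext AT).
exists (others v T); split; first exact: uinv_self.
transitivity (rmul R (others v T) : set L); last exact: pmulC.
by rewrite -JC -IJ -pmulA (pmul_ext AC).
Qed.

Lemma extended_strip v F I : (forall T : {classic subring L}, T \in F -> leaves v T) ->
  (forall T : {classic subring L}, T \in F -> extended I T) ->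
  extended I (strip v F) -> extended I (Dw v).
Proof.
elim: F => [|T F IH] lF eF eI; first by rewrite -(strip0 Theta_pj).
have lF' (S : {classic subring L}) : S \in F -> leaves v S.
  by move=> SF; apply: lF; rewrite in_cons SF orbT.
have eF' (S : {classic subring L}) : S \in F -> extended I S.
  by move=> SF; apply: eF; rewrite in_cons SF orbT.
apply: IH => //; case TF : (T \in F); first by move: eI; rewrite strip_mem.
have sp := strip_splits Theta_pj (lF T (mem_head _ _)) TF.
apply: extended_splits sp _ eI; first exact: base_sub_strip.
by apply: eF; exact: mem_head.
Qed.

Lemma extended_succ v w I : ord_succ v w -> uinv R I -> extended I (Dw w) ->
  exists F, (forall T : {classic subring L}, T \in F -> leaves v T) /\
    extended I (strip v F).
Proof.
move=> vw uI eI.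
have [s [sw ev]] := extended_descends DR (@base_sub_derived _ _ _ Theta_pj _ _ wfW w) uI eI.
have [F [lF sF]] := succ_union Theta_pj vw sw.
by exists F; split=> //; apply: ev => //; exact: base_sub_strip.
Qed.

Lemma extended_limit w I : ord_limit w -> uinv R I -> extended I (Dw w) ->
  exists v, (v < w)%O /\ extended I (Dw v).
Proof.
move=> wl uI eI.
have [s [sw ev]] := extended_descends DR (@base_sub_derived _ _ _ Theta_pj _ _ wfW w) uI eI.
have [v [vw sv]] := limit_union Theta_pj wl sw.
by exists v; split=> //; apply: ev => //; exact: base_sub_derived.
Qed.

End DerivedIdeals.

(** * Direct sums and free abelian groups *)

Section AdditiveMaps.

Lemma additive_of (X Y : zmodType) (f : X -> Y) : {morph f : x y / x + y} ->
  exists F : {additive X -> Y}, forall x, F x = f x.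
Proof.
move=> fD; have fB : zmod_morphism f.
  by move=> x y; apply: (addIr (f y)); rewrite -fD !subrK.
pose F : {additive X -> Y} := HB.pack f (GRing.isZmodMorphism.Build X Y f fB).
by exists F.
Qed.

Lemma additive_factor (X Y Z : zmodType) (p : {additive X -> Y}) (q : {additive X -> Z}) :
  (forall y, exists x, y = p x) -> (forall x, p x = 0 -> q x = 0) ->
  exists r : {additive Y -> Z}, forall x, r (p x) = q x.
Proof.
move=> /choice[s sE] pq.
have rE x : q (s (p x)) = q x.
  by apply/eqP; rewrite -subr_eq0 -raddfB; apply/eqP/pq; rewrite raddfB -sE subrr.
have rD : {morph (q \o s) : x y / x + y}.
  by move=> x y /=; rewrite (sE x) (sE y) -raddfD !rE raddfD.
by have [r rqs] := additive_of rD; exists r => x; rewrite rqs /= rE.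
Qed.

Variables (I : Type) (G : I -> zmodType).

(** Sums over a direct sum are taken along any finite list covering the support,
    so that several elements can share one list. *)
Definition supports (y : dsum G) (s : seq {classic I}) :=
  uniq s /\ forall i : {classic I}, y i != 0 -> i \in s.

Lemma supports_ex (y : dsum G) : exists s, supports y s.
Proof.
have /(@finite_seqP {classic I})[s sE] := dsum_finite y.
exists (undup s); split; first exact: undup_uniq.
move=> i yi; rewrite mem_undup.
by have : [set i | y i != 0] i by []; rewrite sE.
Qed.

Variables (H : zmodType) (phi : forall i, {additive G i -> H}).

Lemma supports_sum (y : dsum G) s s' : supports y s -> supports y s' ->
  \sum_(i <- s) phi i (y i) = \sum_(i <- s') phi i (y i).
Proof.
have red t : \sum_(i <- t) phi i (y i) =
    \sum_(i <- [seq i : {classic I} <- t | y i != 0]) phi i (y i).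
  rewrite big_filter [RHS]big_mkcond /=; apply: eq_bigr => i _.
  by case: eqP => //= ->; rewrite raddf0.
move=> [us ys] [us' ys']; rewrite red [RHS]red; apply: perm_big.
apply: uniq_perm; rewrite ?filter_uniq// => i; rewrite !mem_filter.
by case: (boolP (y i != 0)) => //= yi; rewrite ys// ys'.
Qed.

Lemma dsum_additive : exists F : {additive dsum G -> H},
  forall y s, supports y s -> F y = \sum_(i <- s) phi i (y i).
Proof.
have /choice[supp suppP] := supports_ex.
pose f y := \sum_(i <- supp y) phi i (y i).
have fE y s : supports y s -> f y = \sum_(i <- s) phi i (y i).
  by move=> ys; apply: supports_sum.
suff fD : {morph f : x y / x + y}.
  by have [F FE] := additive_of fD; exists F => y s /fE <-.
move=> x y; pose s := undup (supp x ++ supp y).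
have us : uniq s by exact: undup_uniq.
have sx : supports x s.
  by split=> // i /(suppP x).2 si; rewrite mem_undup mem_cat si.
have sy : supports y s.
  by split=> // i /(suppP y).2 si; rewrite mem_undup mem_cat si orbT.
have sxy : supports (x + y) s.
  split=> // i; apply: contraNT => si.
  have xi : x i = 0 by apply/eqP; apply: contraNT si => /sx.2.
  have yi : y i = 0 by apply/eqP; apply: contraNT si => /sy.2.
  by change (x i + y i == 0); rewrite xi yi addr0.
rewrite (fE _ _ sx) (fE _ _ sy) (fE _ _ sxy) -big_split /=.
by apply: eq_bigr => i _; rewrite -raddfD.
Qed.

End AdditiveMaps.

(** Lift the basis elements through r inside the kernel of k. *)
Lemma free_lift (G H G' : zmodType) (r : {additive H -> G}) (k : {additive H -> G'}) :
  free_abelian G -> (forall c, exists x, r x = c /\ k x = 0) ->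
  exists e : {additive G -> H}, forall c, r (e c) = c /\ k (e c) = 0.
Proof.
move=> [I [f [g fK gK]]] lift.
pose dlt (i j : {classic I}) : int := if i == j then 1 else 0.
have dlt_fin i : finite_set [set j | dlt i j != 0].
  by apply: (sub_finite_set _ (finite_set1 i)) => j; rewrite /= /dlt; case: (eqVneq i j).
pose delta i : dsum (fun _ : I => int) := Dsum (dlt_fin i).
have /choice[x xP] : forall i, exists x, r x = f (delta i) /\ k x = 0 by move=> i; exact: lift.
have phiP i : exists F : {additive int -> H}, forall n, F n = x i *~ n.
  by apply: additive_of => m n; exact: mulrzDr.
have /choice[phi phiE] : forall i, exists F : {additive int -> H}, forall n, F n = x i *~ n by [].
have [Phi PhiE] := dsum_additive phi.
have gD : {morph g : a b / a + b}.
  by move=> a b; apply: (can_inj fK); rewrite gK raddfD !gK.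
have [gA gAE] := additive_of gD.
have [e eE] : exists e : {additive G -> H}, forall c, e c = Phi (g c).
  by apply: additive_of => a b; rewrite gD raddfD.
exists e => c; rewrite eE; have [s sg] := supports_ex (g c).
rewrite (PhiE _ _ sg) !raddf_sum; split; last first.
  by rewrite big1// => i _; rewrite phiE raddfMz (xP i).2 mul0rz.
have decomp : g c = \sum_(i <- s) delta i *~ (g c i).
  apply: dsumP => j.
  have evP : {morph (fun y : dsum (fun _ : I => int) => y j) : y z / y + z} by [].
  have [ev evE] := additive_of evP.
  rewrite -[RHS]evE raddf_sum /=; under eq_bigr do rewrite raddfMz evE /=.
  have [gj|gj] := eqVneq (g c j) 0.
    rewrite big1 ?gj// => i _; rewrite /dlt; case: eqP => [->|_]; last by rewrite mul0rz.
    by rewrite gj.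
  rewrite (bigD1_seq (j : {classic I}))/=; [|exact: sg.2|exact: sg.1].
  rewrite /dlt eqxx intz big1 ?addr0// => i ij.
  by rewrite (negPf ij) mul0rz.
rewrite -[RHS]gK {2}decomp raddf_sum; apply: eq_bigr => i _.
by rewrite phiE !raddfMz (xP i).1.
Qed.

Lemma dsum_single (I : Type) (G : I -> zmodType) (i : I) (c : G i) :
  exists y : dsum G, y i = c /\ forall j, j <> i -> y j = 0.
Proof.
pose y j : G j := match pselect (i = j) with
  | left e => eq_rect i G c j e | right _ => 0 end.
have yi : y i = c.
  by rewrite /y; case: pselect => // e; rewrite (Prop_irrelevance e erefl).
have yj j : j <> i -> y j = 0 by move=> ji; rewrite /y; case: pselect => // ij; case: ji.
have yfin : finite_set [set j | y j != 0].
  apply: (sub_finite_set _ (finite_set1 i)) => j /= yj0.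
  by apply: contrapT => ji; move: yj0; rewrite yj ?eqxx.
by exists (Dsum yfin).
Qed.

(** * Classes of ideals in local Picard groups *)

Section LocalPicardClasses.
Variables (L : fieldType) (B A : subring L) (AB : A `<=` B).
Local Notation invu := (invu B A).

Definition lpic_class (x : invu) : lpicu AB :=
  (\pi_(lpicu AB) (\pi_(picu B A) x))%qT.

Lemma lpic_classD : {morph lpic_class : x y / x + y}.
Proof. by move=> x y; rewrite /lpic_class !raddfD. Qed.

Lemma lpic_class_surj c : exists x, c = lpic_class x.
Proof. by exists (repr (repr c)); rewrite /lpic_class !reprK. Qed.

Lemma lpic_class_eq0 x : lpic_class x = 0 <->
  exists (I : inv_ideal A) (y : invu),
    (\val y : inv_ideal B) = pmul I B :> set L /\ principal B (\val (x - y)).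
Proof.
have pi0 : (\pi_(lpicu AB) 0)%qT = 0 by rewrite raddf0.
rewrite /lpic_class -pi0; split.
  move=> /eqP; rewrite -Quotient.idealrBE subr0 => /asboolP[I [y [yI e]]].
  exists I, y; split=> //; apply/asboolP.
  by move/eqP: e; rewrite -Quotient.idealrBE.
move=> [I [y [yI pxy]]]; apply/eqP; rewrite -Quotient.idealrBE subr0.
apply/asboolP; exists I, y; split=> //; apply/eqP; rewrite -Quotient.idealrBE.
exact/asboolP.
Qed.

End LocalPicardClasses.

Section UnitaryClasses.
Variables (L : fieldType) (D : subring L).
Implicit Types (A B R : subring L) (I J : set L).

Lemma pmul1_pmul c (X Y : set L) : pmul (pmul1 c X) Y = pmul1 c (pmul X Y).
Proof.
apply/seteqP; split.
  apply: pmul_ind => [|_ _ [z hz <-] [w hw <-]|_ y [x Xx <-] Yy].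
  - by exists 0; [exact: pmul0|rewrite mulr0].
  - by exists (z + w); [exact: pmulD|rewrite mulrDr].
  - by exists (x * y); [exact: pmul_mem|rewrite mulrA].
move=> _ [z hz <-]; move: z hz.
apply: (@pmul_ind _ X Y (fun z => pmul (pmul1 c X) Y (c * z))) => [|z w hz hw|x y Xx Yy].
- by rewrite mulr0; exact: pmul0.
- by rewrite mulrDr; exact: pmulD.
- by rewrite mulrA; apply: pmul_mem => //; exists x.
Qed.

Lemma uinv_mul B I J : D `<=` B -> uinv D B I -> uinv D B J -> uinv D B (pmul I J).
Proof.
move=> DB [sI [I' [sI' II' [d [Dd d0 dI dI']]]]] [sJ [J' [sJ' JJ' [e [De e0 eJ eJ']]]]].
split; first exact: submodule_pmul.
exists (pmul I' J'); split; first exact: submodule_pmul.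
  by rewrite pmulA (pmulAC I) -pmulA II' JJ' (@pmul_subring _ B B).
have den X Y : (forall x, X x -> B (d * x)) -> (forall y, Y y -> B (e * y)) ->
    forall z, pmul X Y z -> B (d * e * z).
  move=> dX eY; apply: (@pmul_ind _ X Y (fun z => B (d * e * z))) => [|z w hz hw|x y Xx Yy].
  - by rewrite mulr0; exact: subring0.
  - by rewrite mulrDr; exact: subringD.
  - by rewrite mulrACA; apply: subringM; [exact: dX|exact: eY].
by exists (d * e); split; [exact: subringM|by rewrite mulf_neq0|exact: den|exact: den].
Qed.

Lemma submodule_pmul1 B c : submodule B (pmul1 c B).
Proof.
split; first by exists 0; [exact: subring0|rewrite mulr0].
  by move=> _ _ [z Bz <-] [w Bw <-]; exists (z + w); [exact: subringD|rewrite mulrDr].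
by move=> b _ Bb [z Bz <-]; exists (b * z); [exact: subringM|rewrite mulrCA].
Qed.

Lemma uinv_principal B c : D `<=` B -> quot D c -> c != 0 -> uinv D B (pmul1 c B).
Proof.
move=> DB [p [q [Dp Dq q0 cE]]] c0; split; first exact: submodule_pmul1.
exists (pmul1 c^-1 B); split; first exact: submodule_pmul1.
  by rewrite pmul_principal divff// pmul1_1.
have p0 : p != 0 by apply: contraNneq c0 => p0; rewrite cE p0 mul0r.
exists (p * q); split; [exact: subringM|by rewrite mulf_neq0|move=> _ [z Bz <-]..].
  have -> : p * q * (c * z) = p * p * z by rewrite cE; field.
  by apply: subringM => //; apply: DB; exact: subringM.
have -> : p * q * (c^-1 * z) = q * q * z by rewrite cE; field; rewrite ?p0 ?q0.
by apply: subringM => //; apply: DB; exact: subringM.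
Qed.

Lemma uinv_invertible B I : D `<=` B -> uinv D B I -> invertible B I.
Proof.
move=> DB [sI [J [sJ IJ [d [Dd d0 dI dJ]]]]].
have fr X : submodule B X -> (forall x, X x -> B (d * x)) -> fractional B X.
  move=> sX dX; split=> // [x Xx|].
    exists (d * x), d; split=> //; [exact: dX|exact: DB|by rewrite mulrC mulKf].
  exists d; first by split=> //; exact: DB.
  by move=> _ [x Xx <-]; exact: dX.
by split; [exact: fr|exists J => //; exact: fr].
Qed.

Lemma uinv_denominators A B I : A `<=` quot D -> D `<=` B -> uinv A B I -> uinv D B I.
Proof.
move=> AK DB [sI [J [sJ IJ [d [Ad d0 dI dJ]]]]]; split=> //; exists J; split=> //.
have [p [q [Dp Dq q0 dE]]] := AK _ Ad.
have p0 : p != 0 by apply: contraNneq d0 => p0; rewrite dE p0 mul0r.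
have pE : p = q * d by rewrite dE mulrC divfK.
by exists p; split=> // x hx; rewrite pE -mulrA; apply: subringM; [exact: DB|exact: dI|exact: DB|exact: dJ].
Qed.

Lemma uinv_denominatorsW A B I : D `<=` A -> uinv D B I -> uinv A B I.
Proof.
move=> DA [sI [J [sJ IJ [d [Dd d0 dI dJ]]]]]; split=> //; exists J; split=> //.
by exists d; split=> //; exact: DA.
Qed.

End UnitaryClasses.

Section InvuUinv.
Variables (L : fieldType) (B A : subring L) (AB : A `<=` B).
Implicit Types (I J : set L).

Lemma invertible_uinv I : invertible A I -> uinv A A I.
Proof.
move=> [[sI _ [b [Ab b0] bI]] [J [sJ _ [c [Ac c0] cJ]] IJ]].
split=> //; exists J; split=> //; exists (b * c); split.
- exact: subringM.
- by rewrite mulf_neq0.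
- by move=> x Ix; rewrite mulrAC; apply: subringM => //; apply: bI; exists x.
- by move=> x Jx; rewrite -mulrA; apply: subringM => //; apply: cJ; exists x.
Qed.

Lemma unitaryP I : I 0 -> unitary A I <-> exists a, [/\ quot A a, a != 0 & I a].
Proof.
move=> I0; split=> [nz|[a [Qa a0 Ia]] h].
  apply: contrapT => h; apply: nz; apply/seteqP; split=> [x [Ix Qx]|_ ->] /=.
    by apply: contrapT => /eqP x0; apply: h; exists x.
  by split=> //; exact: (subring0 (quot A)).
have : [set 0 : L] a by rewrite -h.
by move=> /= a0'; rewrite a0' eqxx in a0.
Qed.

(** The condition defines a subgroup. An integral unitary ideal J belongs to it
    because a nonzero a of A in J makes the inverse of J integral. *)
Lemma invu_uinv (x : invu B A) : uinv A B (\val x : inv_ideal B).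
Proof.
case: x => x /= ; rewrite unfold_in inE => /(_ [set J : inv_ideal B | uinv A B J]); apply.
split.
  split=> [|I J uI uJ]; first exact: uinv_self.
  have [J' [uJ' JJ']] := uinv_sym uJ.
  have IJE : (I - J : inv_ideal B) = pmul I J' :> set L.
    have e : pmul (I - J : inv_ideal B) J = I by rewrite -invDE subrK.
    by rewrite -[in RHS]e -pmulA JJ' pmulB//; case: (inv_setP (I - J)) => -[].
  change (uinv A B (I - J : inv_ideal B)); rewrite IJE.
  exact: uinv_mul.
move=> J [iJ uJ]; have [[sJ _ [b [Bb b0] bJ]] [J' [sJ' _ _] JJ']] := inv_setP J.
have [_ [[p [q [Ap Aq q0 ->]]] a0 Ja]] := (unitaryP (let: And3 h _ _ := sJ in h)).1 uJ.
have p0 : p != 0 by apply: contraNneq a0 => ->; rewrite mul0r.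
have Jp : (J : set L) p.
  have -> : p = q * (p / q) by rewrite mulrC divfK.
  by case: sJ => _ _; apply=> //; exact: AB.
split=> //; exists J'; split=> //; exists p; split=> // y hy.
  by apply: subringM; [exact: AB|exact: iJ].
by rewrite -JJ'; exact: pmul_mem.
Qed.

(** I is the quotient of the integral unitary ideals dI and dB. *)
Lemma uinv_invu I : uinv A B I -> exists x : invu B A, (\val x : inv_ideal B) = I :> set L.
Proof.
move=> uI; have [sI [J [sJ IJ [d [Ad d0 dI dJ]]]]] := uI.
pose X := InvIdeal (uinv_invertible AB uI).
have Qd : quot A d by exact: sub_quot.
have uP := uinv_principal AB Qd d0.
pose P := InvIdeal (uinv_invertible AB uP).
have gen_mem (Y : inv_ideal B) : integral B Y -> unitary A Y -> Y \in @invu_pred _ B A.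
  by move=> iY uY; rewrite unfold_in inE => S [_]; apply.
have iP : integral B P.
  by move=> _ [z Bz <-]; apply: subringM => //; exact: AB.
have Pd : (P : set L) d by exists 1; [exact: subring1|rewrite mulr1].
have [e [Ae e0 Ie]] := uinv_mem AB uI.
suff XI : X \in @invu_pred _ B A by exists (Sub X XI).
rewrite -(addrK P X); apply: rpredB; apply: gen_mem => //.
- rewrite /integral invDE; apply: (pmul_sub (B := B)); first exact: submodule_subring.
  by move=> x _ Ix [z Bz <-]; rewrite mulrCA mulrA; apply: subringM => //; exact: dI.
- apply/unitaryP; first by rewrite invDE; exact: pmul0.
  exists (e * d); split; [apply: subringM => //; exact: sub_quot|by rewrite mulf_neq0|].
  by rewrite invDE; exact: pmul_mem.
- apply/unitaryP; first by exists 0; [exact: subring0|rewrite mulr0].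
  by exists d.
Qed.

End InvuUinv.

Lemma invu_eq (L : fieldType) (B A : subring L) (x y : invu B A) :
  (\val x : inv_ideal B) = (\val y : inv_ideal B) :> set L -> x = y.
Proof.
by move=> xy; apply: val_inj; exact: Defs.inv_eq.
Qed.

(** * Pseudo-polynomial extensions *)

Section PseudoPolynomial.
Variables (L : fieldType) (D R : subring L).
Hypotheses (DR : D `<=` R) (pseudo : pseudo_polynomial R D).
Implicit Types (A B : subring L) (I J : set L).
Local Notation K := (quot D).

Lemma base_denominator z : pmul R K z -> exists h, [/\ D h, h != 0 & R (h * z)].
Proof.
move: z; apply: pmul_ind => [|z w [h [Dh h0 hz]] [k [Dk k0 kw]]|r _ Rr [p [q [Dp Dq q0 ->]]]].
- by exists 1; rewrite mulr0; split; [exact: subring1|exact: oner_neq0|exact: subring0].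
- exists (h * k); split; [exact: subringM|by rewrite mulf_neq0|].
  rewrite mulrDr; apply: subringD.
    by rewrite mulrAC; apply: subringM => //; exact: DR.
  by rewrite -mulrA; apply: subringM => //; exact: DR.
- exists q; split=> //; have -> : q * (r * (p / q)) = r * p by field.
  by apply: subringM => //; exact: DR.
Qed.

(** If hz and kz' lie in R, then hz divides the element hk of D in R. So hz
    generates a unitary principal ideal, which is generated by an element of
    D. *)
Lemma unit_factor z z' : pmul R K z -> pmul R K z' -> z * z' = 1 ->
  exists c e e', [/\ K c, R e, R e', e * e' = 1 & z = c * e].
Proof.
move=> /base_denominator[h [Dh h0 Rhz]] /base_denominator[k [Dk k0 Rkz]] zz'.
have z0 : z != 0 by apply: contraTneq (oner_neq0 L) => z0; rewrite -zz' z0 mul0r eqxx.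
have [a Da aE] : exists2 a, D a & pmul1 (h * z) R = pmul1 a R.
  apply: pseudo; first exact: sub_quot.
    by move=> _ [y Ry <-]; exact: subringM.
  apply/unitaryP; first by exists 0; [exact: subring0|rewrite mulr0].
  exists (h * k); split; [apply: sub_quot; exact: subringM|by rewrite mulf_neq0|].
  by exists (k * z') => //; rewrite mulrACA zz' mulr1.
have [e Re eE] : pmul1 a R (h * z) by rewrite -aE; exists 1; [exact: subring1|rewrite mulr1].
have [e' Re' e'E] : pmul1 (h * z) R a by rewrite aE; exists 1; [exact: subring1|rewrite mulr1].
have hz0 : h * z != 0 by rewrite mulf_neq0.
exists (a / h), e, e'; split=> //.
- by exists a, h.
- by apply: (mulfI hz0); rewrite mulr1 (mulrC e) mulrA e'E eE.
- by apply: (mulfI h0); rewrite mulrA mulrCA divff// mulr1 eE.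
Qed.

Lemma pmul1_unit B c e e' : B e -> B e' -> e * e' = 1 -> pmul1 (c * e) B = pmul1 c B.
Proof.
move=> Be Be' ee'; apply/seteqP; split=> _ [z Bz <-].
  by exists (e * z); [exact: subringM|rewrite mulrA].
by exists (e' * z); [exact: subringM|rewrite -mulrA (mulrA e) ee' mul1r].
Qed.

Lemma lpic_class_extended B A (AB : A `<=` B) (x : invu B A) J :
  uinv A A J -> (\val x : inv_ideal B) = pmul J B :> set L -> lpic_class AB x = 0.
Proof.
move=> uJ xJ; apply/lpic_class_eq0.
exists (InvIdeal (uinv_invertible (@subset_refl _ A) uJ)), x; split=> //.
rewrite subrr raddf0; exists 1; split.
- by apply: sub_quot; exact: subring1.
- exact: oner_neq0.
- by rewrite inv0E pmul1_1.
Qed.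

(** A trivial class is a principal ideal zB times an extended one. The ideal zB
    is unitary, so z is a unit of RK and [unit_factor] replaces z by an element
    of K, which can be absorbed into the ideal of A. *)
Lemma lpic_class_eq0_extended B A (AB : A `<=` B) (x : invu B A) :
  D `<=` A -> A `<=` K -> (B : set L) = pmul R A ->
  lpic_class AB x = 0 ->
  exists J, uinv D A J /\ (\val x : inv_ideal B) = pmul J R :> set L.
Proof.
move=> DA AK BE /lpic_class_eq0[I [y [yI [z [Qz z0 xyE]]]]].
have DB := subset_trans DA AB.
have xE : (\val x : inv_ideal B) = pmul (pmul1 z B) (pmul I B) :> set L.
  by rewrite -yI -xyE -invDE -raddfD subrK.
have : uinv D B (pmul1 z B).
  by rewrite -xyE; apply: (uinv_denominators AK DB); exact: invu_uinv.
move=> uz; have [e [De e0 [b Bb zb]]] := uinv_mem DB uz.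
have [_ [_ [_ _ [d [Dd d0 dz _]]]]] := uz.
have BRK : B `<=` pmul R K by rewrite BE; exact: pmulS.
have RKM k w : K k -> pmul R K w -> pmul R K (k * w).
  by have [_ _] := @submodule_pmulr _ K R; apply.
have RKz : pmul R K z.
  have -> : z = d^-1 * (d * z) by rewrite mulKf.
  apply: RKM; first by apply: quotV; exact: sub_quot.
  by apply/BRK/dz; exists 1; [exact: subring1|rewrite mulr1].
have RKz' : pmul R K (e^-1 * b).
  by apply: RKM; [apply: quotV; exact: sub_quot|exact: BRK].
have zz' : z * (e^-1 * b) = 1 by rewrite mulrCA zb mulVf.
have [c [u [u' [Kc Ru Ru' uu' zE]]]] := unit_factor RKz RKz' zz'.
have c0 : c != 0 by apply: contraNneq z0 => c0; rewrite zE c0 mul0r.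
have RB : R `<=` B by rewrite BE; exact: sub_pmulr.
exists (pmul I (pmul1 c A)); split.
  apply: uinv_mul => //; last exact: uinv_principal.
  by apply: (uinv_denominators AK DA); apply: invertible_uinv; exact: inv_setP.
rewrite xE zE (pmul1_unit c (RB _ Ru) (RB _ Ru') uu').
rewrite (pmulC (pmul1 c B)) -pmulA (pmulC B) pmul1_pmul (@pmul_subring _ B B)//.
by rewrite -pmulA pmul1_pmul BE (pmulC A).
Qed.

Section Extension.
Variable A : subring L.
Hypotheses (DA : D `<=` A) (AK : A `<=` K).
Local Notation B := (rmul R A).
Local Notation AB := (@sub_rmulr _ R A).

Lemma invu_base_ext (x : invu R D) :
  exists y : invu B A, (\val y : inv_ideal B) = pmul (\val x : inv_ideal R) A :> set L.
Proof.
have ux : uinv D R (\val x : inv_ideal R) by exact: invu_uinv.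
have := uinv_ext (B' := rmul R A) (@sub_pmulr _ R A) ux.
move=> /(uinv_denominatorsW DA)/(uinv_invu AB)[y yE]; exists y.
rewrite yE [LHS]pmulA; congr pmul; by apply: pmulB; case: ux.
Qed.

Lemma lpic_ext_exists : exists r : {additive lpicu DR -> lpicu AB},
  forall (x : invu R D) (y : invu B A),
  (\val y : inv_ideal B) = pmul (\val x : inv_ideal R) A :> set L ->
  r (lpic_class DR x) = lpic_class AB y.
Proof.
have /choice[ext extE] := invu_base_ext.
have extU (x : invu R D) (y : invu B A) :
    (\val y : inv_ideal B) = pmul (\val x : inv_ideal R) A :> set L -> y = ext x.
  by move=> yE; apply: invu_eq; rewrite yE extE.
have extD : {morph ext : x y / x + y}.
  move=> x y; apply/esym/extU; rewrite !raddfD /= !extE.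
  by rewrite pmulAC -!pmulA (@pmul_subring _ A A).
have [p pE] := additive_of (@lpic_classD _ _ _ DR).
have [q qE] : exists q : {additive invu R D -> lpicu AB},
    forall x, q x = lpic_class AB (ext x).
  by apply: additive_of => x y; rewrite extD lpic_classD.
have [r rE] : exists r : {additive lpicu DR -> lpicu AB}, forall x, r (p x) = q x.
  apply: additive_factor => [c|x].
    by have [x ->] := lpic_class_surj c; exists x; rewrite pE.
  rewrite pE qE => /lpic_class_eq0_extended[//|||J [uJ xJ]]; first exact: sub_quot.
    by rewrite pmul_subring.
  apply: (lpic_class_extended _ (uinv_denominatorsW DA (uinv_ext DA uJ))).
  by rewrite extE xJ /= [RHS]pmulA (pmulAC J A) -[RHS]pmulA (@pmul_subring _ A A).
by exists r => x y /extU->; rewrite -pE rE qE.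
Qed.

End Extension.

End PseudoPolynomial.

(** * The exact sequence *)

Section ExtensionMaps.
Variables (L : fieldType) (D R : subring L).
Hypotheses (DR : D `<=` R) (pseudo : pseudo_polynomial R D).
Implicit Types (A : subring L).
Local Notation K := (quot D).
Local Notation LP A := (lpicu (@sub_rmulr _ R A)).

(** The extension map makes sense for the rings between D and K; it is completed
    by zero to a function of all subrings, so that maps for different rings can
    be compared without carrying proofs. *)
Let lpic_ext_total A : exists r : {additive lpicu DR -> LP A},
  D `<=` A -> A `<=` K -> forall (x : invu R D) (y : invu (rmul R A) A),
  (\val y : inv_ideal (rmul R A)) = pmul (\val x : inv_ideal R) A :> set L ->
  r (lpic_class DR x) = lpic_class (@sub_rmulr _ R A) y.
Proof.
have [[DA AK]|n] := pselect (D `<=` A /\ A `<=` K).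
  by have [r rE] := lpic_ext_exists DR pseudo DA; exists r.
have [r _] : exists r : {additive lpicu DR -> LP A}, forall x, r x = 0.
  by apply: additive_of => x y; rewrite addr0.
by exists r => DA AK; case: n.
Qed.

Definition lpic_ext A := sval (cid (lpic_ext_total A)).

Lemma lpic_ext_class A (x : invu R D) (y : invu (rmul R A) A) :
  D `<=` A -> A `<=` K ->
  (\val y : inv_ideal (rmul R A)) = pmul (\val x : inv_ideal R) A :> set L ->
  lpic_ext A (lpic_class DR x) = lpic_class (@sub_rmulr _ R A) y.
Proof. by move=> DA AK; apply: (svalP (cid (lpic_ext_total A)) DA AK). Qed.

Lemma lpic_ext_eq0 A (x : invu R D) : D `<=` A -> A `<=` K ->
  lpic_ext A (lpic_class DR x) = 0 <-> extended D R (\val x : inv_ideal R) A.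
Proof.
move=> DA AK; have [y yE] := invu_base_ext DR DA x.
rewrite (lpic_ext_class DA AK yE); split=> [|[J [uJ xJ]]].
  move=> /(lpic_class_eq0_extended DR pseudo DA AK)[//|J [uJ yJ]].
  by exists J; rewrite -yE.
apply: (lpic_class_extended _ (uinv_denominatorsW DA uJ)).
rewrite yE xJ [RHS]/= [RHS]pmulA [RHS]pmulAC; congr pmul.
by apply/esym/pmulB; case: uJ.
Qed.

Lemma lpic_ext_mono A A' c : D `<=` A -> A `<=` A' -> A' `<=` K ->
  lpic_ext A c = 0 -> lpic_ext A' c = 0.
Proof.
move=> DA AA' A'K; have [x ->] := lpic_class_surj c.
move/lpic_ext_eq0 => /(_ DA (subset_trans AA' A'K)) ex.
by apply/lpic_ext_eq0 => //; [exact: subset_trans AA'|exact: extended_mono AA' ex].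
Qed.

End ExtensionMaps.

Section ExactSequence.
Variables (L : fieldType) (D R : subring L) (Theta : set (subring L)).
Hypotheses (DR : D `<=` R) (pseudo : pseudo_polynomial R D).
Hypothesis Theta_pj : pre_jaffard D Theta.
Variables (d : Order.disp_t) (W : orderType d).
Hypothesis wfW : well_founded (fun v w : W => (v < w)%O).
Implicit Types (v w u : W) (S T : subring L) (F : seq {classic subring L}).

Local Notation N := (derived_family D Theta wfW).
Local Notation Dw := (derived_ring D Theta wfW).
Local Notation K := (quot D).
Local Notation leaves := (leaves D Theta wfW).
Local Notation others := (others D Theta wfW).
Local Notation strip := (strip D Theta wfW).
Local Notation LP A := (lpicu (@sub_rmulr _ R A)).
Local Notation ext := (lpic_ext DR pseudo).

Let DDw w : D `<=` Dw w. Proof. exact: base_sub_derived. Qed.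
Let DwK w : Dw w `<=` K. Proof. exact: derived_sub_quot. Qed.

Lemma lpic_ext_surj w (c : LP (Dw w)) : exists h, c = ext (Dw w) h.
Proof.
have [y ->] := lpic_class_surj c.
have uy := uinv_denominators (@DwK w) (subset_trans (@DDw w) (@sub_rmulr _ R _))
  (invu_uinv (@sub_rmulr _ R _) y).
have [I [uI IE]] := uinv_lift DR Theta_pj uy; have [x xI] := uinv_invu DR uI.
by exists (lpic_class DR x); apply/esym/lpic_ext_class => //; rewrite xI IE.
Qed.

Lemma lpic_ext_leaf v T (c : LP T) : leaves v T ->
  exists h, ext T h = c /\ ext (others v T) h = 0.
Proof.
move=> lT; have [y ->] := lpic_class_surj c.
have [AT AO TK OK _ _] := leaves_splits Theta_pj lT.
have DT : D `<=` T := subset_trans (@DDw v) AT.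
have DO : D `<=` others v T := subset_trans (@DDw v) AO.
have uy := uinv_denominators TK (subset_trans DT (@sub_rmulr _ R _))
  (invu_uinv (@sub_rmulr _ R _) y).
have [I [uI IE eI]] := uinv_leaf DR Theta_pj lT uy; have [x xI] := uinv_invu DR uI.
exists (lpic_class DR x); split; first by apply: lpic_ext_class => //; rewrite xI IE.
by apply/lpic_ext_eq0 => //; rewrite xI.
Qed.

Lemma lpic_ext_zero w h : ord_zero w -> ext (Dw w) h = 0 -> h = 0.
Proof.
move=> w0; have [x ->] := lpic_class_surj h.
move/lpic_ext_eq0 => /(_ (@DDw w) (@DwK w)); rewrite derived_ring0// => -[J [uJ xJ]].
apply: lpic_class_extended uJ _; rewrite -xJ pmulB//.
by apply: submodule_restrict DR _; case: (invu_uinv DR x).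
Qed.

Lemma lpic_ext_limit w h : ord_limit w -> ext (Dw w) h = 0 ->
  exists v, (v < w)%O /\ ext (Dw v) h = 0.
Proof.
move=> wl; have [x ->] := lpic_class_surj h.
move/lpic_ext_eq0 => /(_ (@DDw w) (@DwK w)) ex.
have [v [vw ev]] := extended_limit DR Theta_pj wl (invu_uinv DR x) ex.
by exists v; split=> //; apply/lpic_ext_eq0.
Qed.

Lemma strip_sub_quot v F : strip v F `<=` K.
Proof. by move=> z []. Qed.

Lemma lpic_ext_succ v w h : ord_succ v w -> ext (Dw w) h = 0 ->
  exists F, (forall T : {classic subring L}, T \in F -> leaves v T) /\
    ext (strip v F) h = 0.
Proof.
move=> vw; have [x ->] := lpic_class_surj h.
move/lpic_ext_eq0 => /(_ (@DDw w) (@DwK w)) ex.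
have [F [lF ev]] := extended_succ DR Theta_pj vw (invu_uinv DR x) ex.
exists F; split=> //; apply/lpic_ext_eq0 => //; first exact: base_sub_strip.
exact: strip_sub_quot.
Qed.

Lemma leaf_over v T : leaves v T -> D `<=` T /\ T `<=` K.
Proof. by move=> [/derived_familyW/(family_overring Theta_pj)]. Qed.

Lemma lpic_ext_strip v F h : (forall T : {classic subring L}, T \in F -> leaves v T) ->
  (forall T : {classic subring L}, T \in F -> ext T h = 0) ->
  ext (strip v F) h = 0 -> ext (Dw v) h = 0.
Proof.
move=> lF; have [x ->] := lpic_class_surj h => eF.
move/lpic_ext_eq0 => /(_ (@base_sub_strip _ _ _ Theta_pj _ _ wfW v F) (@strip_sub_quot v F)) ex.
apply/lpic_ext_eq0 => //; apply: (extended_strip Theta_pj lF) ex => T TF.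
by apply/(lpic_ext_eq0 DR pseudo); [case: (leaf_over (lF T TF))..|exact: eF].
Qed.

Lemma sig_map (X : eqType) (P : X -> Prop) (s : seq X) : (forall x, x \in s -> P x) ->
  exists t : seq {x | P x}, map sval t = s.
Proof.
elim: s => [|x s IH] h; first by exists [::].
have [|t ts] := IH; first by move=> y ys; apply: h; rewrite in_cons ys orbT.
by exists (exist _ x (h x (mem_head _ _)) :: t); rewrite /= ts.
Qed.

Lemma seq_max (X : eqType) (rk : X -> W) (s : seq X) : s <> [::] ->
  exists2 x, x \in s & forall y, y \in s -> (rk y <= rk x)%O.
Proof.
elim: s => // x s IH _; have [->|sn] := pselect (s = [::]).
  by exists x; rewrite ?mem_head// => y; rewrite mem_seq1 => /eqP->.
have [y ys ymax] := IH sn; have [xy|yx] := leP (rk x) (rk y).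
  exists y; first by rewrite in_cons ys orbT.
  by move=> z; rewrite in_cons => /orP[/eqP->|/ymax].
exists x; first exact: mem_head.
move=> z; rewrite in_cons => /orP[/eqP->//|/ymax zy].
exact: le_trans zy (ltW yx).
Qed.

Lemma leaves_unique v w T : leaves v T -> leaves w T -> v = w.
Proof.
move=> lv lw; have [vw|wv|//] := ltgtP v w.
  by case: (leaves_out lv vw); case: lw.
by case: (leaves_out lw wv); case: lv.
Qed.

Variable alpha : W.
Local Notation Idx := {T : subring L | Theta T /\ ~ N alpha T}.
Hypothesis free : forall T : Idx, free_abelian (LP (sval T)).

(** The lift e T of the classes over T dies over every other member of Theta
    still present at the departure of T. Ordered by departure, f is therefore
    triangular, hence injective. The kernel of g is treated by induction on w,
    for all the kernels of the extensions to T_w at once. *)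
Theorem derived_short_exact :
  exists (f : {additive dsum (fun T : Idx => LP (sval T)) -> lpicu DR})
         (g : {additive lpicu DR -> LP (Dw alpha)}),
    short_exact f g.
Proof.
have /choice[rk rkP] : forall T : Idx, exists v, (v < alpha)%O /\ leaves v (sval T).
  by move=> [T [TT NT]]; exact: leaves_exists.
have lf (T : Idx) : leaves (rk T) (sval T) by case: (rkP T).
have eX (T : Idx) : exists e : {additive LP (sval T) -> lpicu DR}, forall c,
    ext (sval T) (e c) = c /\ ext (others (rk T) (sval T)) (e c) = 0.
  by apply: free_lift => [|c]; [exact: free|exact: lpic_ext_leaf].
pose e (T : Idx) := sval (cid (eX T)).
have eT (T : Idx) c : ext (sval T) (e T c) = c by exact: (svalP (cid (eX T)) c).1.
have eO (T : Idx) (A : subring L) c : others (rk T) (sval T) `<=` A -> A `<=` K -> ext A (e T c) = 0.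
  move=> OA AK; apply: (lpic_ext_mono _ OA AK); last exact: (svalP (cid (eX T)) c).2.
  have [_ AO _ _ _ _] := leaves_splits Theta_pj (lf T).
  exact: subset_trans (@DDw _) AO.
have eS (T S : Idx) c : T <> S -> (rk T <= rk S)%O -> ext (sval S) (e T c) = 0.
  move=> TS rTS; apply: eO; last by case: (leaf_over (lf S)).
  apply: others_sub; first by apply: derived_family_anti rTS _ _; case: (lf S).
  move=> ST; apply: TS; apply: eq_sig_hprop => // X p q; exact: Prop_irrelevance.
have [f fE] := dsum_additive e.
have fe (T : Idx) c : exists x, e T c = f x.
  have [x [xT xS]] := @dsum_single Idx (fun T : Idx => LP (sval T)) T c; exists x.
  have sx : supports x [:: T : {classic Idx}].
    split=> // S; rewrite mem_seq1; apply: contraNT => /eqP ST.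
    by rewrite xS ?eqxx.
  by rewrite (fE _ _ sx) big_seq1 xT.
exists f, (ext (Dw alpha)); split; last by move=> z; exact: lpic_ext_surj.
- suff f0 y : f y = 0 -> y = 0.
    by move=> x y xy; apply/eqP; rewrite -subr_eq0; apply/eqP/f0; rewrite raddfB xy subrr.
  have [s sy] := supports_ex y; rewrite (fE _ _ sy) => fy.
  pose t := [seq T : {classic Idx} <- s | y T != 0].
  have [t0|tn] := pselect (t = [::]).
    apply: dsumP => T; apply: contrapT => /eqP yT.
    have : (T : {classic Idx}) \in t by rewrite mem_filter yT; exact: sy.2.
    by rewrite t0.
  (* S indexes a nonzero component of y with the latest departure. *)
  have [S St Smax] := seq_max (rk : {classic Idx} -> W) tn.
  move: St; rewrite mem_filter => /andP[yS sS].
  have := congr1 (ext (sval S)) fy.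
  rewrite raddf_sum raddf0 (bigD1_seq S) ?sy.1//= eT big1 ?addr0 => [yS0|T TS].
    by rewrite yS0 eqxx in yS.
  have [yT|yT] := eqVneq (y T) 0; first by rewrite yT !raddf0.
  apply: eS; first exact/(@eqP {classic Idx}).
  by apply: Smax; rewrite mem_filter yT; exact: sy.2.
- move=> h; split=> [|[y ->]]; last first.
    have [s sy] := supports_ex y; rewrite (fE _ _ sy) raddf_sum big1// => T _.
    apply: eO; last exact: DwK.
    have [ra _] := rkP T; have [_ NT] := svalP T.
    move=> z [Kz Oz]; apply/(derived_ringE Theta_pj); split=> // S NS; apply: Oz; split.
      exact: derived_family_anti (ltW ra) _ NS.
    by move=> ST; apply: NT; rewrite -ST.
  suff : forall w, (w <= alpha)%O -> forall h, ext (Dw w) h = 0 -> exists x, h = f x.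
    by move=> /(_ alpha (lexx _)); apply.
  move=> w; elim/(well_founded_ind wfW): w => w IH wa {}h h0.
  have [w0|[v vw]|wl] := ord_cases w.
  + by exists 0; rewrite raddf0; exact: lpic_ext_zero w0 h0.
  + have [F [lF Fh]] := lpic_ext_succ vw h0.
    have va : (v < alpha)%O := lt_le_trans vw.1 wa.
    have [t tF] : exists t : seq {classic Idx},
        [seq (sval T : {classic subring L}) | T : {classic Idx} <- t] = undup F.
      apply: (@sig_map {classic subring L} (fun T => Theta T /\ ~ N alpha T)) => T.
      rewrite mem_undup => /lF lT; split; last exact: leaves_out lT va.
      by case: lT => /derived_familyW.
    have ut : uniq t.
      have := undup_uniq F; rewrite -tF.
      by move/map_uniq.
    have tP (T : {classic Idx}) : T \in t -> leaves v (sval T).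
      move=> Tt; apply: lF; rewrite -mem_undup -tF.
      exact: (map_f (fun T : {classic Idx} => (sval T : {classic subring L}))).
    have rkt (T : {classic Idx}) : T \in t -> rk T = v.
      by move=> /tP lT; exact: leaves_unique (lf T) lT.
    (* h' vanishes over each dropped member as well as over strip v F. *)
    pose h' := h - \sum_(T <- t) e T (ext (sval T) h).
    have [x' hx'] : exists x, h' = f x.
      apply: (IH v vw.1 (ltW va)); apply: (lpic_ext_strip lF) => [T TF|].
        have : (T : {classic subring L}) \in undup F by rewrite mem_undup.
        rewrite -tF => /mapP[S St ->].
        rewrite raddfB raddf_sum (bigD1_seq (S : {classic Idx}))//= eT big1_seq ?addr0 ?subrr//.
        move=> T' /andP[T'S T't]; apply: eS; first exact/(@eqP {classic Idx}).
        by rewrite !rkt.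
      rewrite raddfB Fh raddf_sum big1_seq ?subrr// => T /andP[_ Tt].
      apply: eO; last exact: strip_sub_quot.
      rewrite (rkt _ Tt) => z [Kz Oz]; split=> // S [NS SF]; apply: Oz; split=> // ST.
      have : (S : {classic subring L}) \in undup F.
        by rewrite -tF ST; exact: (map_f (fun T : {classic Idx} => (sval T : {classic subring L}))).
      by rewrite mem_undup SF.
    have [x'' hx''] : exists x, \sum_(T <- t) e T (ext (sval T) h) = f x.
      apply: (big_ind (fun z => exists x, z = f x)) => [|_ _ [x ->] [y ->]|T _].
      * by exists 0; rewrite raddf0.
      * by exists (x + y); rewrite raddfD.
      * exact: fe.
    by exists (x' + x''); rewrite raddfD -hx' -hx'' subrK.
  + have [v [vw hv]] := lpic_ext_limit wl h0.
    exact: (IH v vw (le_trans (ltW vw) wa)).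
Qed.

End ExactSequence.

Theorem theorem8p4 (D R : idomainType)
    (iota : {rmorphism D -> R}) (eps : {rmorphism R -> D})
    (D_not_field : exists2 x : D, x != 0 & x \isn't a GRing.unit)
    (retract : cancel iota eps)
    (pseudo : pseudo_polynomial (frac_ring R) (base_ring iota))
    (Theta : set (subring {fraction R}))
    (Theta_pj : pre_jaffard (base_ring iota) Theta)
    (d : Order.disp_t) (W : orderType d)
    (wfW : well_founded (fun v w : W => (v < w)%O))
    (alpha : W) :
  let DK := base_ring iota in
  let RL := frac_ring R in
  let N := derived_family DK Theta wfW in
  let Talpha := derived_ring DK Theta wfW alpha in
  let LPicT (T : subring {fraction R}) := lpicu (@sub_rmulr _ RL T) in
  let Idx := {T : subring {fraction R} | Theta T /\ ~ N alpha T} in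
  (forall T : Idx, free_abelian (LPicT (sval T))) ->
  exists (f : {additive dsum (fun T : Idx => LPicT (sval T)) ->
                        lpicu (@sub_base_frac _ _ iota)})
         (g : {additive lpicu (@sub_base_frac _ _ iota) -> LPicT Talpha}),
    short_exact f g.
Proof.
move=> DK RL N Talpha LPicT Idx free.
exact: (derived_short_exact (@sub_base_frac _ _ iota) pseudo Theta_pj free).
Qed.
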